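(* Let $a,b\in\mathbb{R}$ and suppose that the rotation number $r(S_{ab})$ is irrational. (1) For any half-open sector $J=\mathbb{R}^+[\mathbf{v},\mathbf{v}')$, the first return map $T_J:J\to J$ of $T_{ab}$ to $J$ is piecewise linear with at most five pieces. (2) Let $m_+,m_-,n_+,n_-$ be nonnegative integers and set $\mathcal{O}=\mathcal{O}_1\cup\mathcal{O}_2\cup\mathcal{O}_3\cup\mathcal{O}_4$, where $\mathcal{O}_1=\{T_{ab}^{(1+i)}(0,1):0\le i<m_+\}$, $\mathcal{O}_2=\{T_{ab}^{(-i)}(0,1):0\le i<m_-\}$, $\mathcal{O}_3=\{T_{ab}^{(1+i)}(0,-1):0\le i<n_+\}$, $\mathcal{O}_4=\{T_{ab}^{(-i)}(0,-1):0\le i<n_-\}$. Let $J=\mathbb{R}^+[\mathbf{v},\mathbf{v}')$ be a half-open sector with $\mathbf{v},\mathbf{v}'\in\mathcal{O}$ such that no point of $\mathcal{O}$ lies in the interior of $J$. Then the first return map $T_J:J\to J$ is piecewise linear with at most three pieces.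
   Context: For real parameters $a,b$, the map $T_{ab}:\mathbb{R}^2\to\mathbb{R}^2$ is $T_{ab}(x,y)=(ax-y,x)$ if $x\ge 0$ and $T_{ab}(x,y)=(bx-y,x)$ if $x<0$; it is a homeomorphism, positively homogeneous of degree one, mapping rays from the origin onto rays from the origin. $T_{ab}^{(j)}$ denotes the $j$-th iterate ($j\in\mathbb{Z}$). $S_{ab}:S^1\to S^1$, $S_{ab}(\mathbf{u})=T_{ab}(\mathbf{u})/|T_{ab}(\mathbf{u})|$, and $r(S_{ab})$ is its Poincaré rotation number (counterclockwise, in full turns). For nonzero $\mathbf{v},\mathbf{v}'$ not on a common ray, the half-open sector $\mathbb{R}^+[\mathbf{v},\mathbf{v}')$ is the set of points $t\mathbf{w}$, $t>0$, with $\mathbf{w}$ ranging over directions obtained by going counterclockwise from the direction of $\mathbf{v}$ (included) to the direction of $\mathbf{v}'$ (excluded). The first return map $T_J$ to a sector $J$ sends $\mathbf{w}\in J$ to $T_{ab}^{(k)}(\mathbf{w})$ where $k\ge1$ is minimal with $T_{ab}^{(k)}(\mathbf{w})\in J$ (well defined when $r(S_{ab})$ is irrational). A map on $J$ is piecewise linear with at most $k$ pieces if $J$ can be divided by rays from the origin into at most $k$ subsectors on each of which it agrees with a linear map of $\mathbb{R}^2$. *)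

(* Defs.v *)
From Stdlib Require Export Reals Lra ZArith.
Open Scope R_scope.

Definition Pt := (R * R)%type.

Definition Tab (a b : R) (p : Pt) : Pt :=
  let (x, y) := p in
  if Rle_dec 0 x then (a * x - y, x) else (b * x - y, x).

Definition Tab_inv (a b : R) (p : Pt) : Pt :=
  let (u, w) := p in
  (w, (if Rle_dec 0 w then a else b) * w - u).

Definition Titer (a b : R) (j : Z) (p : Pt) : Pt :=
  match j with
  | Z0 => p
  | Zpos q => Nat.iter (Pos.to_nat q) (Tab a b) p
  | Zneg q => Nat.iter (Pos.to_nat q) (Tab_inv a b) p
  end.

Definition scale (t : R) (p : Pt) : Pt := (t * fst p, t * snd p).

Definition rot (th : R) (p : Pt) : Pt :=
  (cos th * fst p - sin th * snd p, sin th * fst p + cos th * snd p).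

Definition unit_pt (t : R) : Pt := (cos (2 * PI * t), sin (2 * PI * t)).

(* F : R -> R is a (continuous, degree one) lift of S_ab(u) = T_ab(u)/|T_ab(u)|
   through the covering t |-> (cos 2 pi t, sin 2 pi t). *)
Definition is_lift_S (a b : R) (F : R -> R) : Prop :=
  continuity F /\
  (forall t, F (t + 1) = F t + 1) /\
  (forall t, exists r, 0 < r /\ Tab a b (unit_pt t) = scale r (unit_pt (F t))).

Definition irrational (x : R) : Prop :=
  ~ exists (p q : Z), q <> 0%Z /\ x = IZR p / IZR q.

(* The Poincare rotation number r(S_ab) (defined mod 1, via any lift) is irrational. *)
Definition rotation_number_irrational (a b : R) : Prop :=
  exists (F : R -> R) (rho : R),
    is_lift_S a b F /\
    Un_cv (fun n => Nat.iter n F 0 / INR n) rho /\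
    irrational rho.

(* v' lies on the ray obtained by rotating the ray of v counterclockwise by
   al, with 0 < al < 2 pi: al is the ccw angle of the sector R^+[v,v'). *)
Definition sector_angle (v v' : Pt) (al : R) : Prop :=
  0 < al < 2 * PI /\ exists s, 0 < s /\ v' = scale s (rot al v).

Definition in_sector (v : Pt) (al : R) (p : Pt) : Prop :=
  exists t th, 0 < t /\ 0 <= th < al /\ p = scale t (rot th v).

Definition in_open_sector (v : Pt) (al : R) (p : Pt) : Prop :=
  exists t th, 0 < t /\ 0 < th < al /\ p = scale t (rot th v).

Definition first_return (a b : R) (v : Pt) (al : R) (p q : Pt) : Prop :=
  exists k : nat, (1 <= k)%nat /\
    in_sector v al (Nat.iter k (Tab a b) p) /\
    (forall j : nat, (1 <= j)%nat -> (j < k)%nat ->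
        ~ in_sector v al (Nat.iter j (Tab a b) p)) /\
    q = Nat.iter k (Tab a b) p.

Definition Mat := (R * R * R * R)%type.
Definition lin (M : Mat) (p : Pt) : Pt :=
  match M with (m11, m12, m21, m22) =>
    (m11 * fst p + m12 * snd p, m21 * fst p + m22 * snd p) end.

(* The first return map to the sector R^+[v,v') (ccw angle al) is (well defined
   and) piecewise linear with at most K pieces: the angular range [0,al) is cut
   by rays at angles th 0 = 0 < th 1 < ... < th n = al (n <= K) into
   subsectors; on the i-th subsector the map agrees with the linear map M i.
   A cutting ray th i (0 < i < n) may belong to either adjacent subsector. *)
Definition pl_first_return (a b : R) (v : Pt) (al : R) (K : nat) : Prop :=
  exists (n : nat) (th : nat -> R) (M : nat -> Mat),
    (1 <= n <= K)%nat /\ th 0%nat = 0 /\ th n = al /\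
    (forall i, (i < n)%nat -> th i < th (S i)) /\
    (forall (i : nat) (t phi : R), (i < n)%nat -> 0 < t ->
       let p := scale t (rot phi v) in
       (th i < phi < th (S i) -> first_return a b v al p (lin (M i) p)) /\
       (phi = th i ->
          first_return a b v al p (lin (M i) p) \/
          ((0 < i)%nat /\ first_return a b v al p (lin (M (pred i)) p)))).

Definition orbit_set (a b : R) (mp mm np nm : nat) (p : Pt) : Prop :=
  exists i : nat,
    ((i < mp)%nat /\ p = Titer a b (Z.of_nat (1 + i)) (0, 1)) \/
    ((i < mm)%nat /\ p = Titer a b (- Z.of_nat i) (0, 1)) \/
    ((i < np)%nat /\ p = Titer a b (Z.of_nat (1 + i)) (0, -1)) \/
    ((i < nm)%nat /\ p = Titer a b (- Z.of_nat i) (0, -1)).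

(* Main.v *)
Require Import Defs.
From Stdlib Require Import Lia List Classical ClassicalEpsilon Wf_nat.

(** Write S for the circle map and F for its lift.  If the matrix of the first return map to
    J changes at an interior point x of J, the forward orbit of x, up to its first return,
    hits an end of J or the vertical axis.  Two such
    points hitting the same point c coincide, since one would be an image of the other
    before its return.  Hence there are at most four of them: c is v, v', (0,1) or (0,-1).
    In part (2) every such orbit enters one of the two orbit segments making up O, and can
    only do so through its first point, which leaves two possible values of c.

    That every point returns to J amounts to S having no wandering arc.  A wandering arc
    may be shrunk so that no iterate of it meets the vertical axis; all iterates of T are then
    linear with determinant 1 on the corresponding cone, and the cross product of the images
    of its two sides is constant.  Denjoy's distortion estimate, applied to |T u| along
    closest return times, contradicts the fact that the images of the arc are disjoint. *)

(** * Least witnesses, and the total length of disjoint intervals on the line and on the circle *)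

Lemma least_nat (P : nat -> Prop) :
  (exists n, P n) -> exists n, P n /\ forall m, (m < n)%nat -> ~ P m.
Proof.
  intros [n Hn]. apply NNPP; intros C. revert Hn.
  induction n as [n IH] using lt_wf_ind. intros Hn. apply C.
  exists n. split; [exact Hn|]. intros m Hm Pm. exact (IH m Hm Pm).
Qed.

Lemma int_shift x y : exists k, y <= x + IZR k < y + 1.
Proof.
  exists (- Int_part (x - y))%Z. rewrite opp_IZR.
  destruct (base_Int_part (x - y)). lra.
Qed.

Definition lsum (f : Z -> R) (js : list Z) : R :=
  fold_right (fun j s => f j + s) 0 js.

Lemma lsum_filter f p js :
  lsum f js = lsum f (filter p js) + lsum f (filter (fun j => negb (p j)) js).
Proof.
  induction js as [|j js IH]; simpl; [ring|].
  rewrite IH. destruct (p j); simpl; ring.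
Qed.

Lemma lsum_ext f g js : (forall j, In j js -> f j = g j) -> lsum f js = lsum g js.
Proof.
  induction js as [|j js IH]; simpl; intros H; [reflexivity|].
  rewrite H, IH; auto.
Qed.

(** The first interval serves as a pivot: the others split into those to its left, inside
    [[A, lo i]], and those to its right, inside [[hi i, B]]; strong induction on the number of
    intervals bounds each group. *)
Lemma disjoint_length_le (lo hi : Z -> R) (js : list Z) : forall A B,
  A <= B -> NoDup js ->
  (forall j, In j js -> A <= lo j <= hi j /\ hi j <= B) ->
  (forall i j, In i js -> In j js -> i <> j -> hi i <= lo j \/ hi j <= lo i) ->
  lsum (fun j => hi j - lo j) js <= B - A.
Proof.
  remember (length js) as n eqn:En. revert js En.
  induction n as [n IH] using lt_wf_ind.
  intros [|i js] -> A B AB ND Hin Hdis; simpl in *; [lra|].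
  apply NoDup_cons_iff in ND. destruct ND as [Hi ND].
  destruct (Hin i (or_introl eq_refl)) as [[H1 H2] H3].
  set (p := fun j => if Rle_dec (hi j) (lo i) then true else false).
  rewrite (lsum_filter _ p).
  assert (HL : lsum (fun j => hi j - lo j) (filter p js) <= lo i - A).
  { apply (IH (length (filter p js))); auto using NoDup_filter.
    - apply Nat.lt_succ_r, filter_length_le.
    - intros j Hj. apply filter_In in Hj. destruct Hj as [Hj Pj].
      unfold p in Pj. destruct (Rle_dec (hi j) (lo i)); [|discriminate].
      destruct (Hin j (or_intror Hj)). lra.
    - intros j k Hj Hk. apply filter_In in Hj, Hk. apply Hdis; tauto. }
  assert (HR : lsum (fun j => hi j - lo j) (filter (fun j => negb (p j)) js) <= B - hi i).
  { apply (IH (length (filter (fun j => negb (p j)) js))); auto using NoDup_filter.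
    - apply Nat.lt_succ_r, filter_length_le.
    - intros j Hj. apply filter_In in Hj. destruct Hj as [Hj Pj].
      unfold p in Pj. destruct (Rle_dec (hi j) (lo i)); [discriminate|].
      destruct (Hin j (or_intror Hj)).
      destruct (Hdis i j (or_introl eq_refl) (or_intror Hj)); [congruence | lra | lra].
    - intros j k Hj Hk. apply filter_In in Hj, Hk. apply Hdis; tauto. }
  lra.
Qed.

(** Each interval is translated so that its left end falls in [[lo i, lo i + 1)], where [i] is the
    first index; the translates are disjoint on the line and stay in this unit window. *)
Lemma disjoint_mod1_length_le (lo hi : Z -> R) (js : list Z) :
  NoDup js -> (forall j, In j js -> lo j < hi j) ->
  (forall i j k, In i js -> In j js -> i <> j \/ k <> 0%Z ->
     hi i <= lo j + IZR k \/ hi j + IZR k <= lo i) ->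
  lsum (fun j => hi j - lo j) js <= 1.
Proof.
  intros ND Hlt Hdis. destruct js as [|i js]; [simpl; lra|].
  set (sh := fun j => (- Int_part (lo j - lo i))%Z).
  assert (Hsh : forall j, lo i <= lo j + IZR (sh j) < lo i + 1).
  { intros j. unfold sh. rewrite opp_IZR. destruct (base_Int_part (lo j - lo i)). lra. }
  rewrite (lsum_ext _ (fun j => (hi j + IZR (sh j)) - (lo j + IZR (sh j))))
    by (intros; ring).
  replace 1 with ((lo i + 1) - lo i) by ring.
  apply (disjoint_length_le (fun j => lo j + IZR (sh j)) (fun j => hi j + IZR (sh j)));
    [lra | exact ND | |].
  - intros j Hj. specialize (Hsh j). assert (Hl := Hlt j Hj).
    (* Comparison with the interval [i] moved one turn forward keeps the right end below [lo i + 1].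
       For [j = i] the shift [sh i] is zero, so the translation by one is nontrivial. *)
    destruct (Hdis j i (1 - sh j)%Z Hj (or_introl eq_refl)) as [H | H].
    + destruct (Z.eq_dec j i) as [-> | Hne]; [right | now left].
      unfold sh. replace (lo i - lo i) with 0 by ring.
      change 0 with (INR 0). rewrite (Int_part_INR 0). discriminate.
    + rewrite minus_IZR in H. lra.
    + rewrite minus_IZR in H. assert (Hl' := Hlt i (or_introl eq_refl)). lra.
  - intros j k Hj Hk Hne.
    destruct (Hdis j k (sh k - sh j)%Z Hj Hk (or_introl Hne)) as [H | H];
      rewrite minus_IZR in H; lra.
Qed.

(** * Iterates with integer exponents *)

(** The shape copies [Titer], which is thereby convertible to an instance ([Titer_ziter]). *)
Definition ziter {A : Type} (f g : A -> A) (j : Z) (x : A) : A :=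
  match j with
  | Z0 => x
  | Zpos q => Nat.iter (Pos.to_nat q) f x
  | Zneg q => Nat.iter (Pos.to_nat q) g x
  end.

Lemma ziter_succ {A : Type} (f g : A -> A) :
  (forall x, f (g x) = x) ->
  forall j x, ziter f g (Z.succ j) x = f (ziter f g j x).
Proof.
  intros fg j x. destruct j as [|p|p].
  - reflexivity.
  - replace (Z.succ (Zpos p)) with (Zpos (Pos.succ p)) by lia.
    simpl. rewrite Pos2Nat.inj_succ. reflexivity.
  - destruct (Pos.eq_dec p 1) as [-> | Hp].
    + simpl. symmetry; apply fg.
    + rewrite <- (Pos.succ_pred p Hp).
      replace (Z.succ (Zneg (Pos.succ (Pos.pred p)))) with (Zneg (Pos.pred p)) by lia.
      simpl. rewrite Pos2Nat.inj_succ. simpl. symmetry; apply fg.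
Qed.

Lemma ziter_nat {A : Type} (f g : A -> A) (n : nat) (x : A) :
  ziter f g (Z.of_nat n) x = Nat.iter n f x.
Proof.
  destruct n as [|n]; [reflexivity|].
  simpl. rewrite SuccNat2Pos.id_succ. reflexivity.
Qed.

(** Suited to iterates of a bijection: going up applies the map, going down cancels it. *)
Lemma Z_shift_ind (P : Z -> Prop) :
  P 0%Z -> (forall j, P j <-> P (Z.succ j)) -> forall j, P j.
Proof.
  intros H0 HS j.
  apply (Z.bi_induction P); auto.
  intros u v ->; tauto.
Qed.

(** * Aperiodic lifts of circle homeomorphisms *)

Section CircleLift.

Variables F G : R -> R.
Hypothesis F_incr : forall x y, x < y -> F x < F y.
Hypothesis FG : forall x, F (G x) = x.
Hypothesis F_one : forall x, F (x + 1) = F x + 1.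

Notation fz := (ziter F G).

Lemma F_inj x y : F x = F y -> x = y.
Proof.
  intros H. destruct (Rtotal_order x y) as [L | [E | L]]; auto;
  apply F_incr in L; lra.
Qed.

Lemma F_shift k : forall x, F (x + IZR k) = F x + IZR k.
Proof.
  revert k. apply (Z_shift_ind (fun k => forall x, F (x + IZR k) = F x + IZR k)).
  - intros x. now rewrite !Rplus_0_r.
  - intros k; split; intros H x.
    + rewrite succ_IZR, <- Rplus_assoc, F_one, H. ring.
    + specialize (H (x - 1)). rewrite succ_IZR in H.
      replace (x - 1 + (IZR k + 1)) with (x + IZR k) in H by ring.
      rewrite H. replace (F x) with (F ((x - 1) + 1)) by (f_equal; ring).
      rewrite F_one. ring.
Qed.

Lemma fz_S j x : fz (Z.succ j) x = F (fz j x).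
Proof. now apply ziter_succ. Qed.

Lemma fz_add i j : forall x, fz (i + j) x = fz i (fz j x).
Proof.
  revert i. apply (Z_shift_ind (fun i => forall x, fz (i + j) x = fz i (fz j x))).
  - reflexivity.
  - intros i; split; intros H x.
    + rewrite Z.add_succ_l, !fz_S. now f_equal.
    + apply F_inj. rewrite <- !fz_S, <- Z.add_succ_l. apply H.
Qed.

Lemma fz_incr j : forall x y, x < y -> fz j x < fz j y.
Proof.
  revert j. apply (Z_shift_ind (fun j => forall x y, x < y -> fz j x < fz j y)).
  - auto.
  - intros j; split; intros H x y L.
    + rewrite !fz_S. auto.
    + apply H in L. rewrite !fz_S in L.
      destruct (Rle_or_lt (fz j y) (fz j x)) as [[C | C] | C]; auto.
      * apply F_incr in C. lra.
      * rewrite C in L; lra.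
Qed.

Lemma fz_shift j k : forall x, fz j (x + IZR k) = fz j x + IZR k.
Proof.
  revert j. apply (Z_shift_ind (fun j => forall x, fz j (x + IZR k) = fz j x + IZR k)).
  - reflexivity.
  - intros j; split; intros H x.
    + rewrite !fz_S, H. apply F_shift.
    + apply F_inj. rewrite F_shift, <- !fz_S. apply H.
Qed.

Lemma fz_add_shift n j k x : fz n (fz j x + IZR k) = fz (n + j) x + IZR k.
Proof. now rewrite fz_shift, fz_add. Qed.

Lemma fzK n x : fz n (fz (- n) x) = x.
Proof. rewrite <- fz_add, Z.add_opp_diag_r. reflexivity. Qed.

Lemma fzVK n x : fz (- n) (fz n x) = x.
Proof. rewrite <- fz_add, Z.add_opp_diag_l. reflexivity. Qed.

Lemma fz_lt_cancel j x y : fz j x < fz j y -> x < y.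
Proof.
  intros H. destruct (Rtotal_order x y) as [L | [-> | L]]; auto; [lra|].
  apply (fz_incr j) in L. lra.
Qed.

Lemma fz_le j x y : x <= y -> fz j x <= fz j y.
Proof. intros [H | ->]; [apply (fz_incr j) in H|]; lra. Qed.

Lemma fz_inj j x y : fz j x = fz j y -> x = y.
Proof.
  intros H. destruct (Rtotal_order x y) as [L | [E | L]]; auto;
  apply (fz_incr j) in L; lra.
Qed.

Hypothesis aperiodic : forall n m x, n <> 0%Z -> fz n x + IZR m <> x.

(** If the orbit of [x] under [H = fz n + m] were bounded, its supremum would be fixed by [H]: an
    increasing bijection can move it neither down nor up. Aperiodicity excludes fixed points. *)
Lemma escape n m x : n <> 0%Z -> x < fz n x + IZR m ->
  forall y, exists j : nat, y < fz (Z.of_nat j * n) x + IZR (Z.of_nat j * m).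
Proof.
  intros Hn Hx y. apply NNPP; intros Hno.
  set (E := fun j => fz (Z.of_nat j * n) x + IZR (Z.of_nat j * m)).
  assert (ES : forall j, E (S j) = fz n (E j) + IZR m).
  { intros j. unfold E. rewrite fz_add_shift, Rplus_assoc, <- plus_IZR.
    f_equal; f_equal; lia. }
  assert (Emono : forall j, E j < E (S j)).
  { induction j as [|j IH].
    - rewrite ES. replace (E 0%nat) with x by (unfold E; simpl; ring). exact Hx.
    - apply (fz_incr n) in IH. rewrite (ES (S j)). rewrite (ES j) at 1. lra. }
  destruct (completeness (fun z => exists j, z = E j)) as [s [Hub Hlub]].
  - exists y. intros z [j ->]. apply Rnot_lt_le. intros C. apply Hno. now exists j.
  - exists (E 0%nat). now exists 0%nat.
  - assert (Hle : forall j, E j <= s) by (intros j; apply Hub; now exists j).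
    assert (Happ : forall z, z < s -> exists j, z < E j).
    { intros z Hz. apply NNPP; intros C.
      assert (s <= z); [|lra]. apply Hlub. intros w [j ->].
      apply Rnot_lt_le. intros D. apply C. now exists j. }
    destruct (Rtotal_order (fz n s + IZR m) s) as [L | [L | L]].
    + destruct (Happ _ L) as [j Hj].
      assert (H1 := Emono j). rewrite ES in H1.
      assert (H2 := fz_le n _ _ (Hle j)). lra.
    + now apply (aperiodic n m s Hn).
    + destruct (Happ (fz (-n) (s - IZR m))) as [j Hj].
      * apply (fz_lt_cancel n). rewrite fzK. lra.
      * apply (fz_incr n) in Hj. rewrite fzK in Hj.
        assert (H1 := Hle (S j)). rewrite ES in H1. lra.
Qed.

(** * Wandering arcs and unvisited arcs *)

(** The translation by [m] turns disjointness on the circle into a condition on the line; with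
    [n = 0] it also keeps the arc from being longer than one turn. *)
Definition wandering (l r : R) : Prop :=
  forall x y n m, l < x < r -> l < y < r -> fz n x + IZR m = y ->
    n = 0%Z /\ m = 0%Z.

(* The left end [l] is the supremum of the visited points below [v]: this makes every
   backward image of the gap [(l, v')] that meets the gap start to the right of [l]. *)
Lemma unvisited_wandering v v' x : v < v' ->
  (forall n k, (1 <= n)%Z -> ~ v < fz n x + IZR k < v') ->
  exists l, l <= v /\ wandering l v'.
Proof.
  intros Hv Hno.
  set (P := fun p => exists n k, (1 <= n)%Z /\ p = fz n x + IZR k).
  assert (PH : forall p n m, (0 <= n)%Z -> P p -> P (fz n (p + IZR m))).
  { intros p n m Hn (i & k & Hi & ->). exists (n + i)%Z, (k + m)%Z. split; [lia|].
    rewrite Rplus_assoc, <- plus_IZR. apply fz_add_shift. }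
  assert (Pin : forall y, exists p, P p /\ y <= p < y + 1).
  { intros y. destruct (int_shift (fz 1 x) y) as [k Hk].
    exists (fz 1 x + IZR k). split; [exists 1%Z, k; split; [lia | reflexivity] | exact Hk]. }
  destruct (completeness (fun p => P p /\ p <= v)) as [l [Hub Hlub]].
  { exists v. intros p [_ Hp]. exact Hp. }
  { destruct (Pin (v - 1)) as (p & Pp & Hp). exists p. split; [exact Pp | lra]. }
  assert (Hlv : l <= v) by (apply Hlub; intros p [_ Hp]; exact Hp).
  assert (gap : forall p, P p -> ~ l < p < v').
  { intros p Pp Hp. destruct (Rle_or_lt p v) as [H | H].
    - assert (p <= l) by (apply Hub; auto). lra.
    - destruct Pp as (n & k & Hn & ->). apply (Hno n k Hn). lra. }
  assert (near : forall z, z < l -> exists p, P p /\ z < p <= l).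
  { intros z Hz. apply NNPP; intros C. assert (l <= z); [|lra].
    apply Hlub. intros p [Pp Hp]. apply Rnot_lt_le; intros D.
    apply C. exists p. split; [exact Pp|]. split; [exact D|]. apply Hub; auto. }
  assert (width : v' - l <= 1).
  { apply Rnot_lt_le; intros C. destruct (Pin (v' - 1)) as (p & Pp & Hp).
    apply (gap p Pp). lra. }
  assert (back : forall x0 y n m, (1 <= n)%Z -> l < x0 < v' -> l < y < v' ->
            fz (- n) x0 + IZR m = y -> False).
  { intros x0 y n m Hn Hx Hy E.
    assert (Hl : fz (- n) l < fz (- n) x0) by (apply fz_incr; lra).
    assert (Hr : fz (- n) x0 < fz (- n) v') by (apply fz_incr; lra).
    (* Let [H = fz (- n) + m]. A visited point between [H l] and [l] would be sent by the inverse of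
       [H] to a visited point of the gap. *)
    assert (H1 : l <= fz (- n) l + IZR m).
    { apply Rnot_lt_le; intros C. destruct (near _ C) as (p & Pp & Hp).
      apply (gap (fz n (p + IZR (- m)))). { apply PH; [lia | exact Pp]. }
      rewrite opp_IZR.
      split; apply (fz_lt_cancel (- n)); rewrite fzVK; lra. }
    destruct H1 as [H1 | H1].
    2: { apply (aperiodic (- n) m l); [lia | auto]. }
    (* Powers of [H] carry [l] past a visited point [p >= v']. At the first passage, [p] lies in the
       image of the gap under the preceding power [H^j], because [H l < v']; undoing [H^j] moves [p]
       by forward iterates into the gap. *)
    destruct (Pin v') as (p & Pp & Hp).
    destruct (escape (- n) m l ltac:(lia) H1 p) as [j0 Hj0].
    destruct (least_nat
      (fun j : nat => p <= fz (Z.of_nat j * - n) l + IZR (Z.of_nat j * m)))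
      as (j & Hj & Hmin).
    { exists j0. lra. }
    destruct j as [|j]. { simpl in Hj. lra. }
    assert (Hp1 : fz (Z.of_nat j * - n) l + IZR (Z.of_nat j * m) < p).
    { apply Rnot_le_lt; intros C. apply (Hmin j); [lia | exact C]. }
    set (i := (Z.of_nat j * - n)%Z) in *. set (k := (Z.of_nat j * m)%Z) in *.
    replace (Z.of_nat (S j) * - n)%Z with (i + - n)%Z in Hj by (unfold i; lia).
    replace (Z.of_nat (S j) * m)%Z with (m + k)%Z in Hj by (unfold k; lia).
    rewrite plus_IZR, <- Rplus_assoc, <- fz_add_shift in Hj.
    assert (H2 : fz i (fz (- n) l + IZR m) < fz i v') by (apply fz_incr; lra).
    apply (gap (fz (- i) (p + IZR (- k)))). { apply PH; [unfold i; lia | exact Pp]. }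
    rewrite opp_IZR.
    split; apply (fz_lt_cancel i); rewrite fzK; lra. }
  exists l. split; [exact Hlv|].
  intros x0 y n m Hx Hy E.
  destruct (Z.lt_trichotomy n 0) as [Hn | [-> | Hn]].
  - exfalso. apply (back x0 y (- n)%Z m); auto; [lia|]. now rewrite Z.opp_involutive.
  - split; [reflexivity|]. simpl in E.
    assert (-1 < IZR m < 1) as [Ha Hb] by lra.
    apply lt_IZR in Ha, Hb. lia.
  - exfalso. apply (back y x0 n (- m)%Z); auto; [lia|].
    rewrite <- E, <- fz_shift, Rplus_assoc, <- plus_IZR, Z.add_opp_diag_r, Rplus_0_r.
    apply fzVK.
Qed.

(** * Closest returns of an orbit to its starting point *)

Section Returns.

Variable x : R.

Definition return_point (y : R) : Prop :=
  exists i k, i <> 0%Z /\ y = fz i x + IZR k /\ x < y <= x + 1.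

Lemma return_point_exists i : i <> 0%Z -> exists k, x < fz i x + IZR k < x + 1.
Proof.
  intros Hi. destruct (int_shift (fz i x) x) as [k [[H | H] H']].
  - exists k. lra.
  - symmetry in H. now apply (aperiodic i k x) in H.
Qed.

(** Only one translate of [fz i x] lies in [(x, x + 1)]; the smaller of it and [y] is kept. *)
Lemma return_point_avoid i y : i <> 0%Z -> return_point y ->
  exists y', return_point y' /\ y' <= y /\ forall k, ~ x < fz i x + IZR k < y'.
Proof.
  intros Hi Hy. destruct (return_point_exists i Hi) as [k Hk].
  assert (Hu : forall k', (k' < k)%Z -> ~ x < fz i x + IZR k').
  { intros k' Hlt. assert (IZR k' <= IZR k - 1); [|lra].
    rewrite <- minus_IZR. apply IZR_le. lia. }
  destruct (Rle_or_lt y (fz i x + IZR k)) as [H | H].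
  - exists y. split; [exact Hy|]. split; [lra|]. intros k' Hk'.
    apply (Hu k'); [|tauto]. apply lt_IZR. lra.
  - exists (fz i x + IZR k). split; [|split; [lra|]].
    + exists i, k. repeat split; auto; lra.
    + intros k' Hk'. apply (Hu k'); [|tauto]. apply lt_IZR. lra.
Qed.

Lemma return_point_nearest (N : nat) : exists y, return_point y /\
  forall i k, (0 < Z.abs i <= Z.of_nat N)%Z -> ~ x < fz i x + IZR k < y.
Proof.
  induction N as [|N (y & Hy & IH)].
  - destruct (return_point_exists 1 ltac:(lia)) as [k Hk].
    exists (fz 1 x + IZR k). split; [|intros; lia].
    exists 1%Z, k. repeat split; [lia | | ]; lra.
  - destruct (return_point_avoid (Z.of_nat (S N)) y ltac:(lia) Hy) as (y1 & Hy1 & L1 & A1).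
    destruct (return_point_avoid (- Z.of_nat (S N)) y1 ltac:(lia) Hy1) as (y2 & Hy2 & L2 & A2).
    exists y2. split; [exact Hy2|]. intros i k Hi Hk.
    destruct (Z.eq_dec i (Z.of_nat (S N))) as [-> | H1].
    { apply (A1 k). lra. }
    destruct (Z.eq_dec i (- Z.of_nat (S N))) as [-> | H2].
    { apply (A2 k). lra. }
    apply (IH i k); [lia | lra].
Qed.

(* If [y = H x] with [H = fz i + k], the point [x + 1] lies between two consecutive
   [H]-iterates of [x]; pull it back between [x] and [H x]. *)
Lemma return_point_closer y : return_point y ->
  exists n m, n <> 0%Z /\ x < fz n x + IZR m < y.
Proof.
  intros (i & k & Hi & -> & Hx & Hx1).
  destruct (least_nat (fun j => x + 1 < fz (Z.of_nat j * i) x + IZR (Z.of_nat j * k)))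
    as (j & Hj & Hmin).
  { now apply escape. }
  destruct j as [|j]. { simpl in Hj. lra. }
  destruct j as [|j].
  { exfalso. rewrite !Z.mul_1_l in Hj. lra. }
  assert (H := Rnot_lt_le _ _ (Hmin (S j) ltac:(lia))).
  assert (Hi' : (Z.of_nat (S j) * i <> 0)%Z) by lia.
  set (e := (Z.of_nat (S j) * i)%Z) in *.
  set (d := (Z.of_nat (S j) * k)%Z) in *.
  replace (Z.of_nat (S (S j)) * i)%Z with (e + i)%Z in Hj by (unfold e; lia).
  replace (Z.of_nat (S (S j)) * k)%Z with (k + d)%Z in Hj by (unfold d; lia).
  rewrite plus_IZR, <- Rplus_assoc, <- fz_add_shift in Hj.
  destruct H as [H | H].
  - exists (- e)%Z, (1 - d)%Z. split; [lia|].
    rewrite minus_IZR.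
    split; apply (fz_lt_cancel e); rewrite <- minus_IZR, fz_shift, fzK, minus_IZR; lra.
  - exfalso. apply (aperiodic e (d - 1) x Hi'). rewrite minus_IZR. lra.
Qed.

(** Take the nearest return up to time [N], then the first time that beats it. That time exceeds
    [N], and its minimality shows that no earlier time comes closer. *)
Lemma closest_returns (N : nat) : exists n m,
  (Z.of_nat N < Z.abs n)%Z /\ x < fz n x + IZR m <= x + 1 /\
  forall i k, (0 < Z.abs i < Z.abs n)%Z -> ~ x < fz i x + IZR k < fz n x + IZR m.
Proof.
  destruct (return_point_nearest N) as (y & Hy & Hno).
  destruct (least_nat (fun q => exists n m, n <> 0%Z /\ x < fz n x + IZR m < y /\
                                 q = Z.abs_nat n)) as (q & (n & m & Hn & H & ->) & Hmin).
  { destruct (return_point_closer y Hy) as (n & m & Hn & H).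
    exists (Z.abs_nat n), n, m. auto. }
  destruct Hy as (_ & _ & _ & _ & Hy).
  exists n, m. split; [|split; [lra|]].
  - apply Z.lt_nge. intros C. apply (Hno n m); [lia | exact H].
  - intros i k Hi Hk. apply (Hmin (Z.abs_nat i)); [lia|].
    exists i, k. repeat split; [lia | lra | lra].
Qed.

(** If arcs [i] and [j] overlapped modulo 1, pulling back would place a translate of an image of
    [x], at a nonzero time shorter than [n], between [x] and its closest return. *)
Lemma return_arcs_length_le n m js :
  (forall i k, (0 < Z.abs i < Z.abs n)%Z -> ~ x < fz i x + IZR k < fz n x + IZR m) ->
  x < fz n x + IZR m <= x + 1 -> NoDup js ->
  (forall i j, In i js -> In j js -> (Z.abs (j - i) < Z.abs n)%Z) ->
  lsum (fun i => fz (i + n) x + IZR m - fz i x) js <= 1.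
Proof.
  intros Hno Hx ND Hjs.
  apply (disjoint_mod1_length_le (fun i => fz i x) (fun i => fz (i + n) x + IZR m)); auto.
  - intros i _. rewrite <- fz_add_shift. apply fz_incr. lra.
  - assert (key : forall i j k, In i js -> In j js -> i <> j \/ k <> 0%Z ->
              fz i x <= fz j x + IZR k -> fz j x + IZR k < fz (i + n) x + IZR m -> False).
    { intros i j k Hi Hj Hne H1 H2.
      rewrite <- fz_add_shift in H2.
      assert (E : fz j x + IZR k = fz i (fz (j - i) x + IZR k)).
      { rewrite fz_add_shift. do 2 f_equal. lia. }
      rewrite E in H1, H2. apply fz_lt_cancel in H2.
      assert (H3 : x <= fz (j - i) x + IZR k).
      { apply Rnot_lt_le. intros C. apply (fz_incr i) in C. lra. }
      destruct (Z.eq_dec (j - i) 0) as [E0 | E0].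
      - rewrite E0 in H2, H3. simpl in H2, H3.
        assert (-1 < IZR k < 1) as [Ha Hb].
        { lra. }
        apply lt_IZR in Ha, Hb. lia.
      - destruct H3 as [H3 | H3].
        + apply (Hno (j - i)%Z k); [specialize (Hjs i j Hi Hj); lia | lra].
        + symmetry in H3. now apply aperiodic in H3. }
    intros i j k Hi Hj Hne.
    destruct (Rle_or_lt (fz i x) (fz j x + IZR k)) as [H | H].
    + left. apply Rnot_lt_le. intros C. now apply (key i j k).
    + right. apply Rnot_lt_le. intros C.
      apply (key j i (- k)%Z); auto; try rewrite opp_IZR; try lra.
      destruct Hne; [left | right]; lia.
Qed.

End Returns.

(** * Lengths and order of the images of a wandering arc *)

Lemma wandering_disjoint l r x y n m : wandering l r -> l < x < r -> l < y < r ->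
  n <> 0%Z \/ m <> 0%Z -> fz n x + IZR m <> y.
Proof. intros W Hx Hy Hne E. destruct (W x y n m Hx Hy E). tauto. Qed.

(** An overlap of two images, pulled back, would place an image of [al] in [[al, be)], inside the
    wandering arc. *)
Lemma wandering_length_le l r al be js : wandering l r ->
  l < al -> al < be -> be < r -> NoDup js ->
  lsum (fun i => fz i be - fz i al) js <= 1.
Proof.
  intros W Hl Hlt Hr ND.
  apply (disjoint_mod1_length_le (fun i => fz i al) (fun i => fz i be)); auto.
  - intros i _. now apply fz_incr.
  - assert (key : forall i j k, i <> j \/ k <> 0%Z ->
              fz i al <= fz j al + IZR k -> fz j al + IZR k < fz i be -> False).
    { intros i j k Hne H1 H2.
      assert (E : fz j al + IZR k = fz i (fz (j - i) al + IZR k)).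
      { rewrite fz_add_shift. do 2 f_equal. lia. }
      rewrite E in H1, H2. apply fz_lt_cancel in H2.
      assert (H3 : al <= fz (j - i) al + IZR k).
      { apply Rnot_lt_le. intros C. apply (fz_incr i) in C. lra. }
      apply (wandering_disjoint l r al (fz (j - i) al + IZR k) (j - i) k W);
        [lra | lra | | reflexivity].
      destruct Hne; [left; lia | now right]. }
    intros i j k _ _ Hne.
    destruct (Rle_or_lt (fz i al) (fz j al + IZR k)) as [H | H].
    + left. apply Rnot_lt_le. intros C. now apply (key i j k).
    + right. apply Rnot_lt_le. intros C.
      apply (key j i (- k)%Z); try rewrite opp_IZR; try lra.
      destruct Hne; [left | right]; lia.
Qed.

(** A nontrivial [H = fz n + m] leaves no point of the arc inside it. If [al] moved right and [be]
    did not, the two images would therefore lie on opposite sides of the whole arc. *)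
Lemma wandering_order l r al be n m : wandering l r ->
  l < al < r -> l < be < r -> n <> 0%Z \/ m <> 0%Z ->
  al < fz n al + IZR m -> be < fz n be + IZR m.
Proof.
  intros W Ha Hb Hne H.
  assert (Hout : forall z, l < z < r -> ~ l < fz n z + IZR m < r).
  { intros z Hz C. now apply (wandering_disjoint l r z (fz n z + IZR m) n m W). }
  apply Rnot_le_lt. intros C.
  assert (H1 := Hout al Ha). assert (H2 := Hout be Hb).
  assert (H3 : r <= fz n al + IZR m) by (apply Rnot_lt_le; intros D; apply H1; lra).
  assert (H4 : fz n be + IZR m <= l) by (apply Rnot_lt_le; intros D; apply H2; lra).
  (* the image of [(be, al)] would cover [(l, r)] *)
  assert (E : forall z, fz n (fz (- n) (z - IZR m)) + IZR m = z).
  { intros z. rewrite fzK. ring. }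
  apply (wandering_disjoint l r (fz (- n) (be - IZR m)) be n m W); auto.
  assert (be < fz (- n) (be - IZR m)).
  { apply (fz_lt_cancel n). rewrite fzK. lra. }
  assert (fz (- n) (be - IZR m) < al).
  { apply (fz_lt_cancel n). rewrite fzK. lra. }
  lra.
Qed.

Lemma wandering_order2 l r al be i k j m : wandering l r ->
  l < al < r -> l < be < r -> i <> j \/ k <> m ->
  fz i al + IZR k < fz j al + IZR m -> fz i be + IZR k < fz j be + IZR m.
Proof.
  intros W Ha Hb Hne H.
  assert (E : forall z, fz j z + IZR m = fz i (fz (j - i) z + IZR (m - k)) + IZR k).
  { intros z. rewrite fz_add_shift, Rplus_assoc, <- plus_IZR. f_equal; f_equal; lia. }
  rewrite E in H |- *.
  apply Rplus_lt_compat_r, fz_incr, (wandering_order l r al); auto.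
  - destruct Hne; [left | right]; lia.
  - apply (fz_lt_cancel i). lra.
Qed.

(** Being a closest return is a matter of the order of the images, which is the same at all points
    of the arc. Thus one time [n] serves both sides in Denjoy's estimate. *)
Lemma wandering_closest l r al be n m : wandering l r ->
  l < al < r -> l < be < r -> n <> 0%Z ->
  al < fz n al + IZR m <= al + 1 ->
  (forall i k, (0 < Z.abs i < Z.abs n)%Z -> ~ al < fz i al + IZR k < fz n al + IZR m) ->
  be < fz n be + IZR m <= be + 1 /\
  (forall i k, (0 < Z.abs i < Z.abs n)%Z -> ~ be < fz i be + IZR k < fz n be + IZR m).
Proof.
  intros W Ha Hb Hn [Hx Hx1] Hno.
  split; [split|].
  - now apply (wandering_order l r al); auto.
  - left. apply (wandering_order2 l r al be n m 0 1); auto.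
    destruct Hx1 as [H | H]; [exact H|].
    exfalso. apply (aperiodic n (m - 1) al Hn). rewrite minus_IZR. lra.
  - intros i k Hi [H1 H2]. apply (Hno i k Hi). split.
    + apply (wandering_order l r be); auto. left; lia.
    + apply (wandering_order2 l r be); auto. left; lia.
Qed.

(** * Denjoy's estimate *)

Fixpoint zrange (e : Z) (q : nat) : list Z :=
  match q with
  | O => nil
  | S q' => (e + Z.of_nat q')%Z :: zrange e q'
  end.

Lemma in_zrange e q i : In i (zrange e q) -> (e <= i < e + Z.of_nat q)%Z.
Proof.
  induction q as [|q IH]; simpl zrange; [intros []|].
  intros [<- | H]; [lia|]. apply IH in H. lia.
Qed.

Lemma NoDup_zrange e q : NoDup (zrange e q).
Proof.
  induction q as [|q IH]; simpl; constructor; auto.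
  intros H. apply in_zrange in H. lia.
Qed.

Lemma many_large (len : Z -> R) (d : R) :
  (forall N : nat, exists q : nat, (N < q)%nat /\ d <= len (Z.of_nat q)) ->
  forall M : nat, exists js, NoDup js /\ INR M * d <= lsum len js.
Proof.
  intros H M.
  (* A bound on the indices is carried along so that the next index is new. *)
  enough (exists js, NoDup js /\ INR M * d <= lsum len js /\
            exists N : nat, forall j, In j js -> (j <= Z.of_nat N)%Z)
    as (js & H1 & H2 & _) by (exists js; auto).
  induction M as [|M (js & ND & Hs & N & HN)].
  - exists nil. repeat split; [constructor | simpl; lra | exists 0%nat; intros j []].
  - destruct (H N) as (q & Hq & Hd). exists (Z.of_nat q :: js). repeat split.
    + constructor; auto. intros C. apply HN in C. lia.
    + rewrite S_INR. simpl. lra.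
    + exists q. intros j [<- | Hj]; [lia|]. apply HN in Hj. lia.
Qed.

(* Denjoy's argument, without derivatives: [N] plays the role of 1/F', and [u i] that of
   the squared length of the [i]-th image of [(al, be)].  Along a closest return time q
   bounded variation of log N gives u_q u_(-q) >= c u_0^2, so the u_q do not tend to 0. *)
Lemma no_wandering l r al be (N : R -> R) (K C : R) (u : Z -> R) :
  (forall x, 0 < N x) -> (forall x k, N (x + IZR k) = N x) -> 0 <= K ->
  (forall x y, N x <= N y * exp (K * Rabs (x - y))) ->
  wandering l r -> l < al -> al < be -> be < r ->
  (forall i, u i = u (Z.succ i) * (N (fz i al) * N (fz i be))) ->
  0 < u 0%Z -> 0 < C -> (forall i, u i <= C * (fz i be - fz i al)) -> False.
Proof.
  intros Npos Nper HK Nlip W Hl Hlt Hr Hu Hu0 HC HuC.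
  assert (Ppos : forall i, 0 < N (fz i al) * N (fz i be))
    by (intros; now apply Rmult_lt_0_compat).
  assert (upos : forall i, 0 < u i).
  { apply Z_shift_ind; [exact Hu0|]. intros i. rewrite (Hu i). split; intros H.
    - apply (Rmult_lt_reg_r (N (fz i al) * N (fz i be))); auto. lra.
    - now apply Rmult_lt_0_compat. }
  set (len := fun i => fz i be - fz i al).
  assert (len1 : forall i, len i <= 1).
  { intros i. assert (H := wandering_length_le l r al be (i :: nil) W Hl Hlt Hr).
    simpl in H. rewrite Rplus_0_r in H. apply H. constructor; [intros [] | constructor]. }
  (* The value comes from [u 0 * u 0 <= u (- q) * u q * exp (2 * K)] together with [u (- q) <= C]
     and [u q <= C * len q]. *)
  set (d := u 0%Z * u 0%Z / (C * C * exp (2 * K))).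
  assert (Hden : 0 < C * C * exp (2 * K)).
  { apply Rmult_lt_0_compat; [nra | apply exp_pos]. }
  assert (Hd : 0 < d).
  { apply Rdiv_lt_0_compat; [nra | exact Hden]. }
  assert (large : forall M : nat, exists q : nat, (M < q)%nat /\ d <= len (Z.of_nat q)).
  { intros M. destruct (closest_returns al M) as (n & m & HM & Hx & Hno).
    assert (Hn : n <> 0%Z) by lia.
    destruct (wandering_closest l r al be n m W) as [Hxb Hnob]; auto; try lra.
    (* With this [e], the return arc of index [e + j] joins [fz j x] and [fz (j - q) x] up to a
       translation, whatever the sign of [n]. *)
    set (q := Z.abs_nat n). set (e := if Z_lt_dec n 0 then 0%Z else (- Z.of_nat q)%Z).
    exists q. split; [lia|].
    set (D := fun x i => fz (i + n) x + IZR m - fz i x).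
    assert (HD : forall x, x = al \/ x = be -> lsum (D x) (zrange e q) <= 1).
    { intros x Hx'. apply (return_arcs_length_le x n m).
      - destruct Hx' as [-> | ->]; auto.
      - destruct Hx' as [-> | ->]; auto.
      - apply NoDup_zrange.
      - intros i j Hi Hj. apply in_zrange in Hi, Hj. lia. }
    assert (HN : forall x j, x < fz n x + IZR m ->
              N (fz j x) <= N (fz (j - Z.of_nat q) x) * exp (K * D x (e + j)%Z)).
    { intros x j Hx'. unfold D, e.
      assert (HDpos : fz (e + j) x < fz (e + j) (fz n x + IZR m)) by now apply fz_incr.
      rewrite fz_add_shift in HDpos. unfold e in HDpos.
      destruct (Z_lt_dec n 0) as [Hs | Hs].
      - replace (0 + j + n)%Z with (j - Z.of_nat q)%Z in * by lia.
        rewrite Z.add_0_l in *.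
        rewrite <- (Nper (fz (j - Z.of_nat q) x) m).
        rewrite <- (Rabs_pos_eq (_ - _)) by lra.
        rewrite Rabs_minus_sym. apply Nlip.
      - replace (- Z.of_nat q + j + n)%Z with j in * by lia.
        replace (- Z.of_nat q + j)%Z with (j - Z.of_nat q)%Z in * by lia.
        rewrite <- (Nper (fz j x) m).
        rewrite <- (Rabs_pos_eq (_ - _)) by lra. apply Nlip. }
    (* Compares [u] from time 0 with [u] from time [- q]. Each step costs the variation of log [N]
       over one return arc at [al] and one at [be]; at [j = q] the left side becomes the square of
       [u 0]. *)
    assert (Hind : forall j : nat,
              u (Z.of_nat j - Z.of_nat q)%Z * u 0%Z <=
              u (- Z.of_nat q)%Z * u (Z.of_nat j) *
              exp (K * (lsum (D al) (zrange e j) + lsum (D be) (zrange e j)))).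
    { induction j as [|j IH].
      - simpl. rewrite !Rplus_0_r, Rmult_0_r, exp_0. lra.
      - replace (lsum (D al) (zrange e (S j)) + lsum (D be) (zrange e (S j))) with
          ((lsum (D al) (zrange e j) + lsum (D be) (zrange e j)) +
           (D al (e + Z.of_nat j)%Z + D be (e + Z.of_nat j)%Z)) by (simpl; ring).
        rewrite Rmult_plus_distr_l, exp_plus, (Rmult_plus_distr_l K (D al _)), exp_plus.
        rewrite (Hu (Z.of_nat j)), (Hu (Z.of_nat j - Z.of_nat q)%Z) in IH.
        rewrite Nat2Z.inj_succ.
        replace (Z.succ (Z.of_nat j) - Z.of_nat q)%Z
          with (Z.succ (Z.of_nat j - Z.of_nat q)) by lia.
        set (E := exp (K * (lsum (D al) (zrange e j) + lsum (D be) (zrange e j)))) in *.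
        assert (HE : 0 < E) by apply exp_pos.
        assert (Ha := HN al (Z.of_nat j) (proj1 Hx)).
        assert (Hb := HN be (Z.of_nat j) (proj1 Hxb)).
        assert (Hab := Rmult_le_compat _ _ _ _ (Rlt_le _ _ (Npos _)) (Rlt_le _ _ (Npos _)) Ha Hb).
        apply (Rmult_le_reg_r (N (fz (Z.of_nat j - Z.of_nat q) al) *
                               N (fz (Z.of_nat j - Z.of_nat q) be))); [apply Ppos|].
        assert (HU : 0 < u (- Z.of_nat q)%Z * u (Z.succ (Z.of_nat j)) * E).
        { apply Rmult_lt_0_compat; [|exact HE]. apply Rmult_lt_0_compat; apply upos. }
        apply (Rmult_le_compat_l _ _ _ (Rlt_le _ _ HU)) in Hab.
        lra. }
    specialize (Hind q). rewrite Z.sub_diag in Hind.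
    assert (Hexp : exp (K * (lsum (D al) (zrange e q) + lsum (D be) (zrange e q)))
                   <= exp (2 * K)).
    { assert (Ha := HD al (or_introl eq_refl)). assert (Hb := HD be (or_intror eq_refl)).
      assert (Hle : K * (lsum (D al) (zrange e q) + lsum (D be) (zrange e q)) <= 2 * K) by nra.
      destruct Hle as [Hle | ->]; [left; now apply exp_increasing | lra]. }
    assert (Hq : u (- Z.of_nat q)%Z * u (Z.of_nat q) <= C * (C * len (Z.of_nat q))).
    { apply Rmult_le_compat; try (apply Rlt_le, upos).
      - apply Rle_trans with (1 := HuC _).
        specialize (len1 (- Z.of_nat q)%Z). unfold len in len1. nra.
      - apply HuC. }
    assert (Hpos := exp_pos (K * (lsum (D al) (zrange e q) + lsum (D be) (zrange e q)))).
    assert (Huu : 0 < u (- Z.of_nat q)%Z * u (Z.of_nat q)).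
    { apply Rmult_lt_0_compat; apply upos. }
    unfold d. apply (Rmult_le_reg_r (C * C * exp (2 * K))); [exact Hden|].
    unfold Rdiv. rewrite Rmult_assoc, Rinv_l by lra. rewrite Rmult_1_r.
    apply Rle_trans with (1 := Hind).
    replace (len (Z.of_nat q) * (C * C * exp (2 * K)))
      with (C * (C * len (Z.of_nat q)) * exp (2 * K)) by ring.
    apply Rmult_le_compat; lra. }
  (* More than [1 / d] disjoint images of length at least [d] do not fit in the circle. *)
  destruct (INR_unbounded (/ d)) as [M HM].
  destruct (many_large len d large M) as (js & ND & Hjs).
  assert (H := wandering_length_le l r al be js W Hl Hlt Hr ND).
  change (lsum len js <= 1) in H.
  apply (Rmult_lt_compat_r d) in HM; [|exact Hd].
  rewrite Rinv_l in HM; lra.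
Qed.

End CircleLift.

(** * The circle map of [Tab] *)

Lemma unit_pt_shift t k : unit_pt (t + IZR k) = unit_pt t.
Proof.
  revert k. apply Z_shift_ind.
  - now rewrite Rplus_0_r.
  - intros k.
    enough (E : unit_pt (t + IZR (Z.succ k)) = unit_pt (t + IZR k)) by now rewrite E.
    unfold unit_pt. rewrite succ_IZR.
    replace (2 * PI * (t + (IZR k + 1))) with (2 * PI * (t + IZR k) + 2 * PI) by ring.
    rewrite cos_plus, sin_plus, cos_2PI, sin_2PI. f_equal; ring.
Qed.

Lemma scale_scale s s' p : scale s (scale s' p) = scale (s * s') p.
Proof. unfold scale; simpl; f_equal; ring. Qed.

Lemma scale_1 p : scale 1 p = p.
Proof. destruct p; unfold scale; simpl; f_equal; ring. Qed.

(** The difference of the angles has zero sine and positive cosine, hence is an even multiple of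
    [PI]. *)
Lemma ray_inj s s' t t' : 0 < s -> 0 < s' ->
  scale s (unit_pt t) = scale s' (unit_pt t') -> exists k, t' = t + IZR k.
Proof.
  intros Hs Hs' E. unfold scale, unit_pt in E; simpl in E. injection E as E1 E2.
  assert (HS : sin (2 * PI * t' - 2 * PI * t) = 0).
  { rewrite sin_minus. apply (Rmult_eq_reg_l (s * s')); [|nra].
    rewrite Rmult_0_r.
    replace (s * s' * (sin (2 * PI * t') * cos (2 * PI * t) - cos (2 * PI * t') * sin (2 * PI * t)))
      with ((s' * sin (2 * PI * t')) * (s * cos (2 * PI * t))
            - (s' * cos (2 * PI * t')) * (s * sin (2 * PI * t))) by ring.
    rewrite <- E1, <- E2. ring. }
  assert (HC : 0 < cos (2 * PI * t' - 2 * PI * t)).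
  { rewrite cos_minus. apply (Rmult_lt_reg_l (s * s')); [nra|].
    rewrite Rmult_0_r.
    replace (s * s' * (cos (2 * PI * t') * cos (2 * PI * t) + sin (2 * PI * t') * sin (2 * PI * t)))
      with ((s' * cos (2 * PI * t')) * (s * cos (2 * PI * t))
            + (s' * sin (2 * PI * t')) * (s * sin (2 * PI * t))) by ring.
    rewrite <- E1, <- E2. assert (H := sin2_cos2 (2 * PI * t)). unfold Rsqr in H.
    assert (0 < s * s) by nra. nra. }
  apply sin_eq_0_0 in HS. destruct HS as [k Hk]. rewrite Hk in HC.
  assert (HPI := PI_RGT_0).
  destruct (Z.Even_or_Odd k) as [[j ->] | [j ->]].
  - exists j. rewrite mult_IZR in Hk.
    apply (Rmult_eq_reg_l (2 * PI)); lra.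
  - exfalso. rewrite plus_IZR, mult_IZR in HC.
    assert (H := unit_pt_shift (1 / 2) j). unfold unit_pt in H. injection H as H _.
    replace (2 * PI * (1 / 2 + IZR j)) with ((2 * IZR j + 1) * PI) in H by field.
    rewrite H in HC. replace (2 * PI * (1 / 2)) with PI in HC by field.
    rewrite cos_PI in HC. lra.
Qed.

Lemma polar (p : Pt) : p <> (0, 0) -> exists s t, 0 < s /\ p = scale s (unit_pt t).
Proof.
  destruct p as [x y]. intros Hp.
  assert (HPI := PI_RGT_0).
  assert (Hn : 0 < x * x + y * y).
  { apply Rnot_le_lt. intros C. apply Hp. f_equal; nra. }
  set (s := sqrt (x * x + y * y)).
  assert (Hs : 0 < s) by now apply sqrt_lt_R0.
  assert (Hss : s * s = x * x + y * y) by (apply sqrt_sqrt; lra).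
  assert (Hc : -1 <= x / s <= 1).
  { split; apply (Rmult_le_reg_r s); auto; unfold Rdiv; rewrite Rmult_assoc, Rinv_l; nra. }
  assert (Hsin : sin (acos (x / s)) = Rabs y / s).
  { rewrite sin_acos by exact Hc.
    replace (1 - (x / s)²) with ((Rabs y / s) * (Rabs y / s)).
    - apply sqrt_square, Rmult_le_pos; [apply Rabs_pos | left; now apply Rinv_0_lt_compat].
    - replace (Rabs y / s * (Rabs y / s)) with ((Rabs y * Rabs y) / (s * s)) by (field; lra).
      rewrite <- Rabs_mult, (Rabs_pos_eq (y * y)) by nra.
      unfold Rsqr. replace (y * y) with (s * s - x * x) by lra. field. lra. }
  destruct (Rle_or_lt 0 y) as [Hy | Hy].
  - exists s, (acos (x / s) / (2 * PI)). split; [exact Hs|].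
    unfold scale, unit_pt; simpl.
    replace (2 * PI * (acos (x / s) / (2 * PI))) with (acos (x / s)) by (field; lra).
    rewrite cos_acos, Hsin, Rabs_pos_eq by auto. f_equal; field; lra.
  - exists s, (- acos (x / s) / (2 * PI)). split; [exact Hs|].
    unfold scale, unit_pt; simpl.
    replace (2 * PI * (- acos (x / s) / (2 * PI))) with (- acos (x / s)) by (field; lra).
    rewrite cos_neg, sin_neg, cos_acos, Hsin, Rabs_left by auto. f_equal; field; lra.
Qed.

Lemma Tab_scale a b s p : 0 < s -> Tab a b (scale s p) = scale s (Tab a b p).
Proof.
  intros Hs. destruct p as [x y]. unfold scale, Tab; simpl.
  destruct (Rle_dec 0 (s * x)), (Rle_dec 0 x); simpl; try (f_equal; ring); exfalso; nra.
Qed.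

Lemma Tab_invK a b p : Tab_inv a b (Tab a b p) = p.
Proof.
  destruct p as [x y]. unfold Tab, Tab_inv.
  destruct (Rle_dec 0 x); destruct (Rle_dec 0 x); try contradiction; f_equal; ring.
Qed.

Lemma Titer_ziter a b j p : Titer a b j p = ziter (Tab a b) (Tab_inv a b) j p.
Proof. reflexivity. Qed.

(** Intermediate values, in informative form: the inverse [G] is extracted from this by
    [proj1_sig]. *)
Lemma lift_inverse F : continuity F -> (forall x, F (x + 1) = F x + 1) ->
  forall y, {x | F x = y}.
Proof.
  intros HF F1 y.
  destruct (archimed (y - F 0)) as [Hu1 Hu2].
  (* [up] exceeds its argument by at most one, so [k - 2] and [k] give the strict signs that [IVT]
     requires. *)
  set (k := up (y - F 0)) in *.
  assert (E1 : F (0 + IZR k) = F 0 + IZR k) by now apply F_shift.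
  assert (E2 : F (0 + IZR (k - 2)) = F 0 + IZR (k - 2)) by now apply F_shift.
  destruct (IVT (F - fct_cte y)%F (0 + IZR (k - 2)) (0 + IZR k)) as [x [_ Hx]].
  - apply continuity_minus; [exact HF | apply continuity_const; intros ? ?; reflexivity].
  - rewrite minus_IZR. lra.
  - unfold minus_fct, fct_cte. rewrite E2, minus_IZR. lra.
  - unfold minus_fct, fct_cte. rewrite E1. lra.
  - exists x. unfold minus_fct, fct_cte in Hx. lra.
Qed.

(** If [F y < F x] with [x < y], then [F] would rise again above [F x] by some [x + k] beyond [y],
    taking the value [F x] a second time. *)
Lemma lift_incr F : continuity F -> (forall x, F (x + 1) = F x + 1) ->
  (forall x y, F x = F y -> x = y) -> forall x y, x < y -> F x < F y.
Proof.
  intros HF F1 Hinj x y Hxy.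
  destruct (Rtotal_order (F x) (F y)) as [H | [H | H]]; [exact H | |].
  { apply Hinj in H. lra. }
  exfalso. destruct (int_shift x y) as [k Hk].
  assert (Hk1 : 0 < IZR k) by lra.
  assert (E : F (x + IZR k) = F x + IZR k) by now apply F_shift.
  destruct (IVT_cor (F - fct_cte (F x))%F y (x + IZR k)) as [z [Hz Ez]].
  - apply continuity_minus; [exact HF | apply continuity_const; intros ? ?; reflexivity].
  - lra.
  - unfold minus_fct, fct_cte. rewrite E. nra.
  - unfold minus_fct, fct_cte in Ez. assert (z = x); [apply Hinj|]; lra.
Qed.

(** [Tab] is injective and homogeneous, so equal values of [F] force [unit_pt x] and [unit_pt y]
    onto one ray; the integer [x - y] is then zero because [F] commutes with translations. *)
Lemma lift_S_inj a b F : is_lift_S a b F -> forall x y, F x = F y -> x = y.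
Proof.
  intros (_ & F1 & HT) x y E.
  destruct (HT x) as (r & Hr & Ex). destruct (HT y) as (r' & Hr' & Ey).
  assert (Hrr : 0 < r / r') by now apply Rdiv_lt_0_compat.
  assert (H : Tab a b (unit_pt x) = Tab a b (scale (r / r') (unit_pt y))).
  { rewrite Tab_scale, Ex, Ey, E, scale_scale by exact Hrr. f_equal. field. lra. }
  apply (f_equal (Tab_inv a b)) in H. rewrite !Tab_invK in H.
  rewrite <- (scale_1 (unit_pt x)) in H.
  destruct (ray_inj _ _ _ _ Rlt_0_1 Hrr H) as [k ->].
  rewrite (F_shift F F1) in E. assert (IZR k = 0) by lra. lra.
Qed.

(** * An irrational rotation number excludes periodic points *)

Section Aperiodic.

Variables F G : R -> R.
Hypothesis F_incr : forall x y, x < y -> F x < F y.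
Hypothesis FG : forall x, F (G x) = x.
Hypothesis F_one : forall x, F (x + 1) = F x + 1.

Lemma periodic_multiple n m x : ziter F G n x = x + IZR m ->
  forall j : nat, ziter F G (Z.of_nat j * n) x = x + INR j * IZR m.
Proof.
  intros E. induction j as [|j IH].
  - simpl. ring.
  - replace (Z.of_nat (S j) * n)%Z with (Z.of_nat j * n + n)%Z by lia.
    rewrite (fz_add F G F_incr FG), E, (fz_shift F G F_incr FG F_one), IH, S_INR. ring.
Qed.

(** If [x] advances by [m] in [q] steps, monotonicity keeps the orbit of 0 within a bounded distance
    of the orbit of [x], so the rotation number would be [m / q]. *)
Lemma irrational_aperiodic rho :
  Un_cv (fun n => Nat.iter n F 0 / INR n) rho -> irrational rho ->
  forall n m x, n <> 0%Z -> ziter F G n x + IZR m <> x.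
Proof.
  intros Hcv Hirr.
  enough (pos : forall (q : nat) m x, (0 < q)%nat ->
            ziter F G (Z.of_nat q) x <> x + IZR m).
  { intros n m x Hn E. destruct (Z_lt_le_dec n 0) as [H | H].
    - apply (pos (Z.to_nat (- n)) m x); [lia|].
      rewrite Z2Nat.id by lia. apply (fz_inj F G F_incr FG n).
      rewrite (fzK F G F_incr FG), (fz_shift F G F_incr FG F_one). auto.
    - apply (pos (Z.to_nat n) (- m)%Z x); [lia|].
      rewrite Z2Nat.id by lia. rewrite opp_IZR. lra. }
  intros q m x Hq E. apply Hirr. exists m, (Z.of_nat q). split; [lia|].
  rewrite <- INR_IZR_INZ.
  assert (Hq0 : 0 < INR q) by now apply lt_0_INR.
  destruct (int_shift (- Rabs x) 0) as [K HK].
  assert (Hx : 0 + IZR (- K) <= x <= 0 + IZR K).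
  { rewrite opp_IZR. assert (H1 := Rle_abs x). assert (H2 := Rle_abs (- x)).
    rewrite Rabs_Ropp in H2. lra. }
  assert (Hdist : forall j : nat,
            Rabs (Nat.iter (j * q) F 0 - INR j * IZR m) <= Rabs x + IZR K).
  { intros j. assert (Hj := periodic_multiple _ _ _ E j).
    rewrite <- Nat2Z.inj_mul in Hj.
    destruct Hx as [Hx1 Hx2].
    apply (fz_le F G F_incr FG (Z.of_nat (j * q))) in Hx1, Hx2.
    rewrite (fz_shift F G F_incr FG F_one), ziter_nat in Hx1.
    rewrite (fz_shift F G F_incr FG F_one), (ziter_nat _ _ _ 0) in Hx2.
    rewrite opp_IZR in Hx1. rewrite Hj in Hx1, Hx2.
    assert (H1 := Rle_abs x). assert (H2 := Rle_abs (- x)). rewrite Rabs_Ropp in H2.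
    apply Rabs_le. lra. }
  apply (Rmult_eq_reg_r (INR q)); [|lra].
  replace (IZR m / INR q * INR q) with (IZR m) by (field; lra).
  apply cond_eq. intros eps Heps.
  set (B := Rabs x + IZR K).
  assert (HB : 0 <= B) by (unfold B; assert (H := Rabs_pos x); lra).
  destruct (Hcv (eps / 2 / INR q)) as [N0 HN].
  { apply Rdiv_lt_0_compat; lra. }
  destruct (INR_unbounded (2 * B / eps)) as [M HM].
  (* Large enough both for convergence at time [j * q] and for [B / j] to fall below [eps / 2]. *)
  set (j := (S (max N0 M))%nat).
  assert (Hj0 : 0 < INR j) by (apply lt_0_INR; lia).
  assert (HjM : 2 * B / eps < INR j).
  { apply Rlt_le_trans with (1 := HM). apply le_INR. lia. }
  specialize (HN (j * q)%nat ltac:(nia)). unfold Rdist in HN.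
  rewrite mult_INR in HN. specialize (Hdist j). fold B in Hdist.
  set (y := Nat.iter (j * q) F 0) in *.
  replace (rho * INR q - IZR m)
    with (- ((y / (INR j * INR q) - rho) * INR q) + (y - INR j * IZR m) * / INR j)
    by (field; lra).
  apply Rle_lt_trans with (1 := Rabs_triang _ _).
  rewrite Rabs_Ropp, !Rabs_mult, (Rabs_pos_eq (INR q)), (Rabs_pos_eq (/ INR j));
    [|left; now apply Rinv_0_lt_compat | lra].
  assert (H1 : Rabs (y / (INR j * INR q) - rho) * INR q < eps / 2).
  { apply (Rmult_lt_compat_r (INR q)) in HN; [|exact Hq0].
    replace (eps / 2 / INR q * INR q) with (eps / 2) in HN by (field; lra). exact HN. }
  assert (H2 : Rabs (y - INR j * IZR m) * / INR j <= eps / 2).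
  { apply (Rmult_le_reg_r (INR j)); [exact Hj0|].
    rewrite Rmult_assoc, Rinv_l by lra.
    apply (Rmult_lt_compat_r eps) in HjM; [|exact Heps].
    replace (2 * B / eps * eps) with (2 * B) in HjM by (field; lra). lra. }
  lra.
Qed.

End Aperiodic.

Lemma Tab_right a b x y : 0 <= x -> Tab a b (x, y) = (a * x - y, x).
Proof. intros H. unfold Tab. destruct (Rle_dec 0 x); [reflexivity | contradiction]. Qed.

(** The two formulas agree on the vertical axis, so each is valid on a closed half plane. *)
Lemma Tab_left a b x y : x <= 0 -> Tab a b (x, y) = (b * x - y, x).
Proof.
  intros H. unfold Tab. destruct (Rle_dec 0 x) as [H' | H']; [|reflexivity].
  replace x with 0 by lra. f_equal; ring.
Qed.

(** * The vertical axis in terms of angles, and the distortion of the circle map *)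

Lemma cos_turn_continuity : continuity (fun t => cos (2 * PI * t)).
Proof.
  apply (continuity_comp (fun t => 2 * PI * t) cos).
  - apply derivable_continuous. reg.
  - apply continuity_cos.
Qed.

Lemma cos_turn_zero_between x y : x < y -> cos (2 * PI * x) * cos (2 * PI * y) < 0 ->
  exists t, x < t < y /\ cos (2 * PI * t) = 0.
Proof.
  intros Hxy H.
  destruct (IVT_cor _ x y cos_turn_continuity) as (t & Ht & E); [lra | lra |].
  exists t. split; [|exact E].
  split; apply Rnot_le_lt; intros C.
  - replace x with t in H by lra. rewrite E in H. lra.
  - replace y with t in H by lra. rewrite E in H. lra.
Qed.

(** In turns, these are the directions of [(0, 1)] and [(0, -1)], where [Tab] changes its matrix. *)
Lemma cos_turn_zero t : cos (2 * PI * t) = 0 ->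
  exists k, t = 1 / 4 + IZR k \/ t = 3 / 4 + IZR k.
Proof.
  intros H. apply cos_eq_0_0 in H. destruct H as [k Hk].
  assert (HPI := PI_RGT_0).
  assert (Ht : t = IZR k / 2 + 1 / 4).
  { apply (Rmult_eq_reg_l (2 * PI)); [|lra]. rewrite Hk. field. }
  destruct (Z.Even_or_Odd k) as [[j ->] | [j ->]]; exists j; [left | right];
    rewrite Ht, ?plus_IZR, mult_IZR; field.
Qed.

Lemma cos_lip x y : Rabs (cos x - cos y) <= Rabs (x - y).
Proof.
  destruct (MVT_abs cos (fun t => - sin t) y x) as (c & E & _).
  - intros c _. apply derivable_pt_lim_cos.
  - rewrite E. rewrite <- (Rmult_1_l (Rabs (x - y))) at 2.
    apply Rmult_le_compat_r; [apply Rabs_pos|].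
    rewrite Rabs_Ropp. apply Rabs_le. apply SIN_bound.
Qed.

Lemma sin_lip x y : Rabs (sin x - sin y) <= Rabs (x - y).
Proof.
  destruct (MVT_abs sin cos y x) as (c & E & _).
  - intros c _. apply derivable_pt_lim_sin.
  - rewrite E. rewrite <- (Rmult_1_l (Rabs (x - y))) at 2.
    apply Rmult_le_compat_r; [apply Rabs_pos|].
    apply Rabs_le. apply COS_bound.
Qed.

Definition norm2 (p : Pt) : R := fst p * fst p + snd p * snd p.

Lemma norm2_scale s p : norm2 (scale s p) = s * s * norm2 p.
Proof. unfold norm2, scale; simpl; ring. Qed.

Lemma norm2_unit t : norm2 (unit_pt t) = 1.
Proof.
  unfold norm2, unit_pt; simpl. assert (H := sin2_cos2 (2 * PI * t)).
  unfold Rsqr in H. lra.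
Qed.

(** On either side of zero the function is linear; across zero, [x] and [y] are each at most
    [Rabs (x - y)] in absolute value. *)
Lemma Tab_unit_fst_lip a b x y d : 0 <= d -> Rabs (x - y) <= d ->
  Rabs ((if Rle_dec 0 x then a else b) * x - (if Rle_dec 0 y then a else b) * y)
    <= (Rabs a + Rabs b) * d.
Proof.
  intros Hd H.
  assert (Ha := Rabs_pos a). assert (Hb := Rabs_pos b).
  apply Rle_trans with ((Rabs a + Rabs b) * Rabs (x - y)).
  2: { apply Rmult_le_compat_l; lra. }
  assert (Ea : a <= Rabs a /\ - a <= Rabs a).
  { split; [apply Rle_abs | rewrite <- Rabs_Ropp; apply Rle_abs]. }
  assert (Eb : b <= Rabs b /\ - b <= Rabs b).
  { split; [apply Rle_abs | rewrite <- Rabs_Ropp; apply Rle_abs]. }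
  destruct (Rle_dec 0 x), (Rle_dec 0 y);
    apply Rabs_le; unfold Rabs at 3 6; destruct (Rcase_abs (x - y)); split; nra.
Qed.

(** A Lipschitz function bounded away from zero has a Lipschitz logarithm: the squared norm has
    Lipschitz constant [L] and lower bound [1 / (3 + 2 * M * M)], and [1 + z <= exp z]. This is the
    distortion bound required by [no_wandering]. *)
Lemma Tab_unit_norm_lip a b : exists K, 0 <= K /\ forall x y,
  norm2 (Tab a b (unit_pt x)) <= norm2 (Tab a b (unit_pt y)) * exp (K * Rabs (x - y)).
Proof.
  assert (HPI := PI_RGT_0).
  set (M := Rabs a + Rabs b).
  assert (HM : 0 <= M) by (unfold M; assert (H1 := Rabs_pos a); assert (H2 := Rabs_pos b); lra).
  (* Differences of squares: the first coordinate of the image contributes [2 * (M + 1) * (M + 1)],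
     the second contributes 2, and [2 * PI] converts turns to radians. *)
  set (L := (2 * (M + 1) * (M + 1) + 2) * (2 * PI)).
  assert (HL : 0 <= L) by (unfold L; apply Rmult_le_pos; nra).
  set (A := fun t => if Rle_dec 0 (cos (2 * PI * t)) then a else b).
  assert (HA : forall t, Rabs (A t) <= M).
  { intros t. unfold A, M. assert (H1 := Rabs_pos a). assert (H2 := Rabs_pos b).
    destruct (Rle_dec _ _); lra. }
  assert (E : forall t, norm2 (Tab a b (unit_pt t)) =
            (A t * cos (2 * PI * t) - sin (2 * PI * t)) *
            (A t * cos (2 * PI * t) - sin (2 * PI * t))
            + cos (2 * PI * t) * cos (2 * PI * t)).
  { intros t. unfold norm2, Tab, unit_pt, A. destruct (Rle_dec _ _); reflexivity. }
  (* With [p] the first coordinate of the image, [s = A t * c - p] bounds [s * s] by [c * c] and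
     [p * p]; then [c * c + s * s = 1] gives the constant. *)
  assert (low : forall t, 1 <= (3 + 2 * M * M) * norm2 (Tab a b (unit_pt t))).
  { intros t. rewrite E. assert (H := sin2_cos2 (2 * PI * t)). unfold Rsqr in H.
    set (c := cos _) in *. set (s := sin _) in *.
    assert (HAA : A t * A t <= M * M).
    { rewrite <- (Rabs_pos_eq (A t * A t)), Rabs_mult by nra.
      apply Rmult_le_compat; auto using Rabs_pos. }
    set (p := A t * c - s). assert (Hs : s = A t * c - p) by (unfold p; ring).
    assert (Hs2 : s * s <= 2 * (A t * A t) * (c * c) + 2 * (p * p)).
    { rewrite Hs. assert (H0 := Rle_0_sqr (A t * c + p)). unfold Rsqr in H0. nra. }
    assert (A t * A t * (c * c) <= M * M * (c * c)) by (apply Rmult_le_compat_r; nra).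
    assert (0 <= M * M * (p * p)) by nra.
    assert (0 <= p * p) by nra. assert (0 <= c * c) by nra. lra. }
  exists (L * (3 + 2 * M * M)). split; [nra|]. intros x y.
  set (d := Rabs (x - y)). assert (Hd : 0 <= d) by apply Rabs_pos.
  assert (Hlip : norm2 (Tab a b (unit_pt x)) <= norm2 (Tab a b (unit_pt y)) + L * d).
  { rewrite !E.
    assert (Hc := cos_lip (2 * PI * x) (2 * PI * y)).
    assert (Hs := sin_lip (2 * PI * x) (2 * PI * y)).
    replace (2 * PI * x - 2 * PI * y) with (2 * PI * (x - y)) in Hc, Hs by ring.
    rewrite Rabs_mult, (Rabs_pos_eq (2 * PI)) in Hc, Hs by lra. fold d in Hc, Hs.
    assert (Hg := Tab_unit_fst_lip a b (cos (2 * PI * x)) (cos (2 * PI * y)) (2 * PI * d)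
                    ltac:(nra) Hc).
    fold (A x) (A y) M in Hg.
    assert (Hp : forall t, Rabs (A t * cos (2 * PI * t) - sin (2 * PI * t)) <= M + 1).
    { intros t. unfold Rminus. apply Rle_trans with (1 := Rabs_triang _ _).
      rewrite Rabs_Ropp, Rabs_mult.
      assert (H1 : Rabs (cos (2 * PI * t)) <= 1) by (apply Rabs_le, COS_bound).
      assert (H2 : Rabs (sin (2 * PI * t)) <= 1) by (apply Rabs_le, SIN_bound).
      specialize (HA t). assert (H3 := Rabs_pos (A t)). assert (H4 := Rabs_pos (cos (2 * PI * t))).
      nra. }
    assert (Hpx := Hp x). assert (Hpy := Hp y).
    assert (Hcx : Rabs (cos (2 * PI * x)) <= 1) by (apply Rabs_le, COS_bound).
    assert (Hcy : Rabs (cos (2 * PI * y)) <= 1) by (apply Rabs_le, COS_bound).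
    set (gx := A x * cos (2 * PI * x)) in *. set (gy := A y * cos (2 * PI * y)) in *.
    set (cx := cos (2 * PI * x)) in *. set (cy := cos (2 * PI * y)) in *.
    set (sx := sin (2 * PI * x)) in *. set (sy := sin (2 * PI * y)) in *.
    assert (Hsq : forall u v B D, Rabs u <= B -> Rabs v <= B -> Rabs (u - v) <= D ->
              u * u - v * v <= 2 * B * D).
    { intros u v B D Hu Hv Huv. apply Rle_trans with (1 := Rle_abs _).
      replace (u * u - v * v) with ((u + v) * (u - v)) by ring.
      rewrite Rabs_mult. apply Rmult_le_compat; auto using Rabs_pos.
      apply Rle_trans with (1 := Rabs_triang _ _). lra. }
    assert (H1 : (gx - sx) * (gx - sx) - (gy - sy) * (gy - sy)
                 <= 2 * (M + 1) * ((M + 1) * (2 * PI * d))).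
    { apply Hsq; auto.
      replace (gx - sx - (gy - sy)) with ((gx - gy) + - (sx - sy)) by ring.
      apply Rle_trans with (1 := Rabs_triang _ _). rewrite Rabs_Ropp. lra. }
    assert (H2 := Hsq cx cy 1 (2 * PI * d) Hcx Hcy Hc).
    unfold L. lra. }
  specialize (low y). set (Ny := norm2 (Tab a b (unit_pt y))) in *.
  assert (HNy : 0 < Ny) by nra.
  assert (Hexp := exp_ineq1_le (L * (3 + 2 * M * M) * d)).
  apply Rle_trans with (Ny * (1 + L * (3 + 2 * M * M) * d)).
  - assert (0 <= L * d) by nra.
    assert (L * d * 1 <= L * d * ((3 + 2 * M * M) * Ny)) by (apply Rmult_le_compat_l; auto).
    lra.
  - apply Rmult_le_compat_l; lra.
Qed.

(** Between two zeros of the cosine [Tab] is a single matrix of determinant 1, so it preserves the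
    cross product of the two directions. Squaring replaces lengths by [norm2] and removes signs. *)
Lemma lift_S_cross a b F x y : is_lift_S a b F -> x < y ->
  (forall t, x < t < y -> cos (2 * PI * t) <> 0) ->
  (sin (2 * PI * (y - x)))² = (sin (2 * PI * (F y - F x)))² *
    (norm2 (Tab a b (unit_pt x)) * norm2 (Tab a b (unit_pt y))).
Proof.
  intros (_ & _ & HT) Hxy Hno.
  destruct (HT x) as (r & Hr & Ex). destruct (HT y) as (r' & Hr' & Ey).
  assert (Hsign : 0 <= cos (2 * PI * x) * cos (2 * PI * y)).
  { apply Rnot_lt_le. intros C. destruct (cos_turn_zero_between x y Hxy C) as (t & Ht & E).
    now apply (Hno t). }
  rewrite Ex, Ey, !norm2_scale, !norm2_unit.
  unfold unit_pt, scale in Ex, Ey. cbn [fst snd] in Ex, Ey.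
  set (cx := cos (2 * PI * x)) in *. set (cy := cos (2 * PI * y)) in *.
  set (sx := sin (2 * PI * x)) in *. set (sy := sin (2 * PI * y)) in *.
  set (Cx := cos (2 * PI * F x)) in *. set (Cy := cos (2 * PI * F y)) in *.
  set (Sx := sin (2 * PI * F x)) in *. set (Sy := sin (2 * PI * F y)) in *.
  assert (HA : exists A, Tab a b (cx, sx) = (A * cx - sx, cx) /\
                         Tab a b (cy, sy) = (A * cy - sy, cy)).
  { assert (Hcase : (0 <= cx /\ 0 <= cy) \/ (cx <= 0 /\ cy <= 0)).
    { destruct (Rle_or_lt 0 cx) as [H1 | H1], (Rle_or_lt 0 cy) as [H2 | H2]; auto.
      - right. split; [|lra]. apply Rnot_lt_le. intros C. nra.
      - right. split; [lra|]. apply Rnot_lt_le. intros C. nra.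
      - right. lra. }
    destruct Hcase as [[H1 H2] | [H1 H2]].
    - exists a. rewrite !Tab_right by auto. auto.
    - exists b. rewrite !Tab_left by auto. auto. }
  destruct HA as (A & EA1 & EA2).
  rewrite EA1 in Ex. rewrite EA2 in Ey. injection Ex as E1 E2. injection Ey as E3 E4.
  assert (Hcross : sin (2 * PI * (y - x)) = r * r' * sin (2 * PI * (F y - F x))).
  { replace (2 * PI * (y - x)) with (2 * PI * y - 2 * PI * x) by ring.
    replace (2 * PI * (F y - F x)) with (2 * PI * F y - 2 * PI * F x) by ring.
    rewrite !sin_minus. fold cx cy sx sy Cx Cy Sx Sy.
    replace (r * r' * (Sy * Cx - Cy * Sx)) with ((r * Cx) * (r' * Sy) - (r' * Cy) * (r * Sx)) by ring.
    rewrite <- E1, <- E2, <- E3, <- E4. ring. }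
  rewrite Hcross. unfold Rsqr. ring.
Qed.

(** * Every forward orbit visits every arc *)

Section Visits.

Variables a b : R.
Variables F G : R -> R.
Hypothesis F_lift : is_lift_S a b F.
Hypothesis F_incr : forall x y, x < y -> F x < F y.
Hypothesis FG : forall x, F (G x) = x.
Hypothesis F_one : forall x, F (x + 1) = F x + 1.
Notation fz := (ziter F G).
Hypothesis aperiodic : forall n m x, n <> 0%Z -> fz n x + IZR m <> x.

(** A wandering arc contains at most one point of the full orbit of [c], so one of its halves
    contains none. *)
Lemma wandering_avoid c l r : wandering F G l r -> l < r ->
  exists l' r', l <= l' < r' /\ r' <= r /\ forall i k, ~ l' < fz i c + IZR k < r'.
Proof.
  intros W Hlr. set (m := (l + r) / 2).
  destruct (classic (exists i k, l < fz i c + IZR k < m)) as [(i & k & H) | H].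
  2: { exists l, m. unfold m in *. repeat split; try lra. intros i k C. apply H. now exists i, k. }
  exists m, r. unfold m in *. repeat split; try lra. intros i' k' C.
  assert (E : fz (i' - i) (fz i c + IZR k) + IZR (k' - k) = fz i' c + IZR k').
  { rewrite (fz_add_shift F G F_incr FG F_one), Rplus_assoc, <- plus_IZR.
    f_equal; f_equal; lia. }
  destruct (W (fz i c + IZR k) (fz i' c + IZR k') (i' - i)%Z (k' - k)%Z) as [H1 H2]; auto;
    try lra.
  replace i' with i in C by lia. replace k' with k in C by lia. lra.
Qed.

Lemma wandering_sub l r l' r' : wandering F G l r -> l <= l' -> r' <= r -> wandering F G l' r'.
Proof. intros W H1 H2 x y n m Hx Hy E. apply (W x y n m); auto; lra. Qed.

(** An unvisited arc yields a wandering one, to which [no_wandering] applies with [u i] the squared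
    cross product of the directions of the [i]-th images of its two sides. *)
Lemma visits x v v' : v < v' -> exists n k, (1 <= n)%Z /\ v < fz n x + IZR k < v'.
Proof.
  intros Hv. apply NNPP. intros C.
  destruct (unvisited_wandering F G F_incr FG F_one aperiodic v v' x Hv) as (l & Hl & W).
  { intros n k Hn Hk. apply C. now exists n, k. }
  (* Two shrinkings keep all images of the arc off the two vertical directions. *)
  destruct (wandering_avoid (1 / 4) l v' W) as (l1 & r1 & H1 & H1' & A1); [lra|].
  assert (W1 := wandering_sub _ _ _ _ W (proj1 H1) H1').
  destruct (wandering_avoid (3 / 4) l1 r1 W1) as (l2 & r2 & H2 & H2' & A2); [lra|].
  assert (W2 := wandering_sub _ _ _ _ W1 (proj1 H2) H2').
  (* [d] is the distance from [al] to [be]; the bound [1 / 4] makes [sin (2 * PI * d)] positive,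
     hence [u 0] nonzero. *)
  set (d := Rmin ((r2 - l2) / 3) (1 / 4)).
  assert (Hd : 0 < d /\ d <= (r2 - l2) / 3 /\ d <= 1 / 4).
  { unfold d. split; [apply Rmin_glb_lt; lra | split; [apply Rmin_l | apply Rmin_r]]. }
  set (al := l2 + d). set (be := l2 + 2 * d).
  assert (Hab : l2 < al /\ al < be /\ be < r2) by (unfold al, be; lra).
  assert (Hno : forall i t, fz i al < t < fz i be -> cos (2 * PI * t) <> 0).
  { intros i t Ht E. apply cos_turn_zero in E.
    assert (Hpre : forall c k, t = c + IZR k -> l2 < fz (- i) c + IZR k < r2).
    { intros c k ->. rewrite <- (fz_shift F G F_incr FG F_one).
      assert (al < fz (- i) (c + IZR k) < be); [|lra].
      split; apply (fz_lt_cancel F G F_incr FG i); rewrite (fzK F G F_incr FG); lra. }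
    destruct E as [k [E | E]]; apply Hpre in E.
    - apply (A1 (- i)%Z k). lra.
    - apply (A2 (- i)%Z k). lra. }
  destruct (Tab_unit_norm_lip a b) as (K & HK & Hlip).
  assert (HPI := PI_RGT_0).
  assert (Hmono : forall i, fz i al < fz i be) by (intros; apply fz_incr; auto; lra).
  apply (no_wandering F G F_incr FG F_one aperiodic l2 r2 al be
           (fun t => norm2 (Tab a b (unit_pt t))) K (2 * PI)
           (fun i => (sin (2 * PI * (fz i be - fz i al)))²)); auto; try lra.
  - intros t. destruct F_lift as (_ & _ & HT). destruct (HT t) as (r & Hr & ->).
    rewrite norm2_scale, norm2_unit. nra.
  - intros t k. now rewrite unit_pt_shift.
  - intros i. rewrite !(fz_S F G FG).
    apply lift_S_cross; [exact F_lift | apply Hmono | apply Hno].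
  - apply Rlt_0_sqr. apply Rgt_not_eq, sin_gt_0; simpl; unfold al, be; nra.
  - intros i. specialize (Hmono i). set (z := 2 * PI * (fz i be - fz i al)).
    assert (Hz : 0 < z) by (unfold z; apply Rmult_lt_0_compat; lra).
    assert (H := sin_lip z 0). rewrite sin_0, !Rminus_0_r, (Rabs_pos_eq z) in H by lra.
    assert (Hs : Rabs (sin z) <= 1) by (apply Rabs_le, SIN_bound).
    rewrite Rsqr_abs. unfold Rsqr. assert (H0 := Rabs_pos (sin z)).
    change (2 * PI * (fz i be - fz i al)) with z. nra.
Qed.

End Visits.

(** * First return maps *)

Lemma increasing_le (th : nat -> R) n : (forall i, (i < n)%nat -> th i < th (S i)) ->
  forall i j, (i <= j)%nat -> (j <= n)%nat -> th i <= th j.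
Proof.
  intros H i j Hij. induction Hij as [|j Hij IH]; intros Hj; [lra|].
  specialize (H j ltac:(lia)). specialize (IH ltac:(lia)). lra.
Qed.

(** Each [c] is related by [cl] to at most one point of [(lo, hi)], so treating it costs at most one
    new cut. *)
Lemma partition_avoiding (cl : R -> R -> Prop) lo hi (cs : list R) : lo < hi ->
  (forall c x y, lo < x < hi -> lo < y < hi -> cl c x -> cl c y -> x = y) ->
  exists (n : nat) (th : nat -> R),
    (1 <= n <= S (length cs))%nat /\ th 0%nat = lo /\ th n = hi /\
    (forall i, (i < n)%nat -> th i < th (S i)) /\
    (forall i x c, (i < n)%nat -> th i < x < th (S i) -> In c cs -> ~ cl c x).
Proof.
  intros Hlt Huniq. induction cs as [|c cs (n & th & Hn & H0 & Hhi & Hinc & Hav)].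
  - exists 1%nat, (fun i => match i with O => lo | _ => hi end).
    split; [simpl; lia|]. do 2 (split; [reflexivity|]). split.
    + intros i Hi. destruct i; [exact Hlt | lia].
    + intros i x c _ _ [].
  - destruct (classic (exists i x, (i < n)%nat /\ th i < x < th (S i) /\ cl c x))
      as [(i0 & x0 & Hi0 & Hx0 & Hc) | Hnone].
    2: { exists n, th. simpl. split; [lia|]. do 3 (split; [assumption|]).
         intros i x c' Hi Hx [<- | Hc'] C; [|now apply (Hav i x c')].
         apply Hnone. exists i, x. auto. }
    (* Inserts [x0] as cut number [S i0]; later cuts move up by one index. *)
    set (th' := fun j => if (j <=? i0)%nat then th j
                         else if (j =? S i0)%nat then x0 else th (pred j)).
    assert (L : forall j, (j <= i0)%nat -> th' j = th j).
    { intros j Hj. unfold th'. apply Nat.leb_le in Hj. now rewrite Hj. }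
    assert (E : th' (S i0) = x0).
    { unfold th'. rewrite (proj2 (Nat.leb_gt (S i0) i0)) by lia. now rewrite Nat.eqb_refl. }
    assert (U : forall j, (i0 < j)%nat -> th' (S j) = th j).
    { intros j Hj. unfold th'. rewrite (proj2 (Nat.leb_gt (S j) i0)) by lia.
      now rewrite (proj2 (Nat.eqb_neq (S j) (S i0))) by lia. }
    assert (Hinc' : forall i, (i < S n)%nat -> th' i < th' (S i)).
    { intros i Hi. destruct (lt_eq_lt_dec i i0) as [[H | ->] | H].
      - rewrite !L by lia. apply Hinc. lia.
      - rewrite L, E by lia. tauto.
      - destruct (Nat.eq_dec i (S i0)) as [-> | Hne].
        + rewrite E, U by lia. tauto.
        + destruct i as [|i]; [lia|]. rewrite !U by lia. apply Hinc. lia. }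
    assert (T0 : th' 0%nat = lo) by (rewrite L by lia; exact H0).
    assert (Tn : th' (S n) = hi) by (rewrite U by lia; exact Hhi).
    exists (S n), th'. simpl. split; [lia|]. do 3 (split; [assumption|]).
    intros i x c' Hi Hx Hc' C.
    assert (Hxin : lo < x < hi).
    { assert (H1 := increasing_le th' (S n) Hinc' 0 i ltac:(lia) ltac:(lia)).
      assert (H2 := increasing_le th' (S n) Hinc' (S i) (S n) ltac:(lia) ltac:(lia)). lra. }
    assert (Hx0in : lo < x0 < hi).
    { assert (H1 := increasing_le th n Hinc 0 i0 ltac:(lia) ltac:(lia)).
      assert (H2 := increasing_le th n Hinc (S i0) n ltac:(lia) ltac:(lia)). lra. }
    destruct Hc' as [<- | Hc'].
    + assert (x = x0) by now apply (Huniq c). subst x.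
      destruct (le_lt_dec (S i0) i) as [H | H].
      * assert (H1 := increasing_le th' (S n) Hinc' (S i0) i H ltac:(lia)). lra.
      * assert (H1 := increasing_le th' (S n) Hinc' (S i) (S i0) ltac:(lia) ltac:(lia)). lra.
    + destruct (lt_eq_lt_dec i i0) as [[H | ->] | H].
      * rewrite !L in Hx by lia. apply (Hav i x c'); auto; lia.
      * rewrite L, E in Hx by lia. apply (Hav i0 x c'); auto. lra.
      * destruct (Nat.eq_dec i (S i0)) as [-> | Hne].
        -- rewrite E, U in Hx by lia. apply (Hav i0 x c'); auto. lra.
        -- destruct i as [|i]; [lia|]. rewrite !U in Hx by lia.
           apply (Hav i x c'); auto; lia.
Qed.

(** * Linear pieces of [Tab], and sectors read as arcs measured in turns *)

Definition mat_mul (M N : Mat) : Mat :=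
  match M, N with (m11, m12, m21, m22), (n11, n12, n21, n22) =>
    (m11 * n11 + m12 * n21, m11 * n12 + m12 * n22,
     m21 * n11 + m22 * n21, m21 * n12 + m22 * n22)
  end.

Lemma lin_mat_mul M N p : lin (mat_mul M N) p = lin M (lin N p).
Proof.
  destruct M as [[[m11 m12] m21] m22], N as [[[n11 n12] n21] n22], p as [x y].
  unfold lin, mat_mul; simpl. f_equal; ring.
Qed.

(** The cosine cannot take both signs on [[u, w)]; at [u], where it may vanish, either formula
    applies. *)
Lemma Tab_linear_between a b u w :
  (forall t, u < t < w -> cos (2 * PI * t) <> 0) ->
  exists M, forall z s, 0 < s -> u <= z < w ->
    Tab a b (scale s (unit_pt z)) = lin M (scale s (unit_pt z)).
Proof.
  intros Hno.
  assert (same : forall z z', u <= z < w -> u <= z' < w ->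
            cos (2 * PI * z) < 0 -> 0 < cos (2 * PI * z') -> False).
  { intros z z' Hz Hz' H H'.
    destruct (Rtotal_order z z') as [L | [-> | L]]; [| lra |].
    - destruct (cos_turn_zero_between z z' L ltac:(nra)) as (t & Ht & E).
      apply (Hno t); [lra | exact E].
    - destruct (cos_turn_zero_between z' z L ltac:(nra)) as (t & Ht & E).
      apply (Hno t); [lra | exact E]. }
  destruct (classic (exists z, u <= z < w /\ cos (2 * PI * z) < 0)) as [(z0 & Hz0 & H0) | H].
  - exists (b, -1, 1, 0). intros z s Hs Hz. unfold scale, unit_pt; cbn [fst snd].
    rewrite Tab_left; [unfold lin; simpl; f_equal; ring|].
    assert (cos (2 * PI * z) <= 0); [|nra].
    apply Rnot_lt_le. intros C. now apply (same z0 z).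
  - exists (a, -1, 1, 0). intros z s Hs Hz. unfold scale, unit_pt; cbn [fst snd].
    rewrite Tab_right; [unfold lin; simpl; f_equal; ring|].
    assert (0 <= cos (2 * PI * z)); [|nra].
    apply Rnot_lt_le. intros C. apply H. now exists z.
Qed.

Lemma rot_ray th s t :
  rot th (scale s (unit_pt t)) = scale s (unit_pt (t + th / (2 * PI))).
Proof.
  assert (HPI := PI_RGT_0). unfold rot, scale, unit_pt; cbn [fst snd].
  replace (2 * PI * (t + th / (2 * PI))) with (2 * PI * t + th) by (field; lra).
  rewrite cos_plus, sin_plus. f_equal; ring.
Qed.

Lemma in_sector_ray s0 t0 al s t : 0 < s0 -> 0 < s ->
  in_sector (scale s0 (unit_pt t0)) al (scale s (unit_pt t)) <->
  exists k, t0 <= t + IZR k < t0 + al / (2 * PI).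
Proof.
  intros Hs0 Hs. assert (HPI := PI_RGT_0). split.
  - intros (r & th & Hr & Hth & E). rewrite rot_ray, scale_scale in E.
    apply ray_inj in E; [|exact Hs | now apply Rmult_lt_0_compat].
    destruct E as [k E]. exists k. rewrite <- E. split.
    + assert (0 <= th / (2 * PI)); [|lra]. apply Rle_mult_inv_pos; lra.
    + apply Rplus_lt_compat_l, Rmult_lt_compat_r; [apply Rinv_0_lt_compat|]; lra.
  - intros [k Hk]. exists (s / s0), (2 * PI * (t + IZR k - t0)). split; [|split; [split|]].
    + now apply Rdiv_lt_0_compat.
    + apply Rmult_le_pos; lra.
    + replace al with (2 * PI * (al / (2 * PI))) by (field; lra).
      apply Rmult_lt_compat_l; lra.
    + rewrite rot_ray, scale_scale.
      replace (t0 + 2 * PI * (t + IZR k - t0) / (2 * PI)) with (t + IZR k) by (field; lra).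
      rewrite unit_pt_shift. f_equal. field. lra.
Qed.

Lemma in_open_sector_ray s0 t0 al s t k : 0 < s0 -> 0 < s ->
  t0 < t + IZR k < t0 + al / (2 * PI) ->
  in_open_sector (scale s0 (unit_pt t0)) al (scale s (unit_pt t)).
Proof.
  intros Hs0 Hs Hk. assert (HPI := PI_RGT_0).
  exists (s / s0), (2 * PI * (t + IZR k - t0)). split; [|split; [split|]].
  - now apply Rdiv_lt_0_compat.
  - apply Rmult_lt_0_compat; lra.
  - replace al with (2 * PI * (al / (2 * PI))) by (field; lra).
    apply Rmult_lt_compat_l; lra.
  - rewrite rot_ray, scale_scale.
    replace (t0 + 2 * PI * (t + IZR k - t0) / (2 * PI)) with (t + IZR k) by (field; lra).
    rewrite unit_pt_shift. f_equal. field. lra.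
Qed.

Section FirstReturn.

Variables a b : R.
Variables F G : R -> R.
Hypothesis F_lift : is_lift_S a b F.
Hypothesis F_incr : forall x y, x < y -> F x < F y.
Hypothesis FG : forall x, F (G x) = x.
Hypothesis F_one : forall x, F (x + 1) = F x + 1.
Notation fz := (ziter F G).
Hypothesis aperiodic : forall n m x, n <> 0%Z -> fz n x + IZR m <> x.

Lemma Tab_ray s t : 0 < s ->
  exists s', 0 < s' /\ Tab a b (scale s (unit_pt t)) = scale s' (unit_pt (F t)).
Proof.
  intros Hs. destruct F_lift as (_ & _ & HT). destruct (HT t) as (r & Hr & E).
  exists (s * r). split; [now apply Rmult_lt_0_compat|].
  now rewrite Tab_scale, E, scale_scale.
Qed.

Lemma Tab_inv_ray s t : 0 < s ->
  exists s', 0 < s' /\ Tab_inv a b (scale s (unit_pt t)) = scale s' (unit_pt (G t)).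
Proof.
  intros Hs. destruct F_lift as (_ & _ & HT). destruct (HT (G t)) as (r & Hr & E).
  assert (Hsr : 0 < s / r) by now apply Rdiv_lt_0_compat.
  exists (s / r). split; [exact Hsr|].
  rewrite <- (Tab_invK a b (scale (s / r) _)), Tab_scale, E, FG, scale_scale by exact Hsr.
  do 2 f_equal. field. lra.
Qed.

Lemma Titer_ray j s t : 0 < s ->
  exists s', 0 < s' /\ Titer a b j (scale s (unit_pt t)) = scale s' (unit_pt (fz j t)).
Proof.
  intros Hs. unfold Titer, ziter. destruct j as [|q|q].
  - now exists s.
  - induction (Pos.to_nat q) as [|n (s' & Hs' & E)]; simpl; [now exists s|].
    rewrite E. now apply Tab_ray.
  - induction (Pos.to_nat q) as [|n (s' & Hs' & E)]; simpl; [now exists s|].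
    rewrite E. now apply Tab_inv_ray.
Qed.

Lemma iter_Tab_ray (n : nat) s t : 0 < s ->
  exists s', 0 < s' /\
    Nat.iter n (Tab a b) (scale s (unit_pt t)) = scale s' (unit_pt (fz (Z.of_nat n) t)).
Proof.
  intros Hs. destruct (Titer_ray (Z.of_nat n) s t Hs) as (s' & Hs' & E).
  exists s'. split; [exact Hs'|]. now rewrite <- E, Titer_ziter, ziter_nat.
Qed.

(** * Returns to an arc and the points where the matrix may change *)

Variables t0 la : R.
Hypothesis Hla : 0 < la < 1.

Definition in_arc (z : R) : Prop := exists k, t0 <= z + IZR k < t0 + la.
Definition in_open_arc (z : R) : Prop := exists k, t0 < z + IZR k < t0 + la.
Definition arc_end (z : R) : Prop := exists k, z + IZR k = t0 \/ z + IZR k = t0 + la.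

Lemma open_arc_arc z : in_open_arc z -> in_arc z.
Proof. intros [k Hk]. exists k. lra. Qed.

Lemma arc_end_not_open z : arc_end z -> ~ in_open_arc z.
Proof.
  intros (k & E) (k' & H).
  destruct E as [E | E].
  - assert (IZR k < IZR k' < IZR (k + 1)) as [H1 H2] by (rewrite plus_IZR; lra).
    apply lt_IZR in H1, H2. lia.
  - assert (IZR (k - 1) < IZR k' < IZR k) as [H1 H2] by (rewrite minus_IZR; lra).
    apply lt_IZR in H1, H2. lia.
Qed.

(** The arc is closed on the left and open on the right, so a change met while moving right from [u]
    occurs at an end beyond [u], possibly at [w] itself. *)
Lemma arc_change u w : u < w -> ~ (in_arc w <-> in_arc u) ->
  exists e, u < e <= w /\ arc_end e.
Proof.
  intros Huw H. destruct (classic (in_arc u)) as [Hu | Hu].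
  - assert (Hw : ~ in_arc w) by tauto. destruct Hu as [k Hk].
    exists (t0 + la - IZR k). split.
    + split; [lra|]. apply Rnot_lt_le. intros C. apply Hw. exists k. lra.
    + exists k. right. ring.
  - assert (Hw : in_arc w) by tauto. destruct Hw as [k Hk].
    exists (t0 - IZR k). split.
    + split; [|lra]. apply Rnot_le_lt. intros C. apply Hu. exists k. lra.
    + exists k. left. ring.
Qed.

Definition return_time (k : nat) (z : R) : Prop :=
  (1 <= k)%nat /\ in_arc (fz (Z.of_nat k) z) /\
  forall j, (1 <= j < k)%nat -> ~ in_arc (fz (Z.of_nat j) z).

Lemma return_time_exists z : exists k, return_time k z.
Proof.
  destruct (visits a b F G F_lift F_incr FG F_one aperiodic z t0 (t0 + la)) as (n & k & Hn & H).
  { lra. }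
  destruct (least_nat (fun j => (1 <= j)%nat /\ in_arc (fz (Z.of_nat j) z)))
    as (j & [Hj Hin] & Hmin).
  { exists (Z.to_nat n). split; [lia|]. rewrite Z2Nat.id by lia. exists k. lra. }
  exists j. split; [exact Hj|]. split; [exact Hin|].
  intros i Hi C. apply (Hmin i); [lia|]. split; [lia | exact C].
Qed.

(** Testing the open arc lets the orbit land on an end of the arc, as happens in [break]. *)
Definition quiet (n : nat) (z : R) : Prop :=
  forall i, (1 <= i <= n)%nat -> ~ in_open_arc (fz (Z.of_nat i) z).

(** The candidates for a change of matrix. The second alternative includes [n = 0]: the point itself
    may lie on the vertical axis. *)
Definition break (z : R) : Prop :=
  t0 < z < t0 + la /\ exists n, quiet n z /\
    (((1 <= n)%nat /\ arc_end (fz (Z.of_nat n) z)) \/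
     cos (2 * PI * fz (Z.of_nat n) z) = 0).

Definition hits (c z : R) : Prop :=
  exists (n j : nat) (k : Z), quiet n z /\ (j <= n)%nat /\ fz (Z.of_nat j) z + IZR k = c.

(** If [x] reaches [c] in [i] steps and [y] in [j >= i] steps, then [x] is the image of [y] at time
    [j - i]; as [x] lies in the open arc, quietness of [y] forces [i = j]. *)
Lemma hits_unique c x y : t0 < x < t0 + la -> t0 < y < t0 + la ->
  hits c x -> hits c y -> x = y.
Proof.
  enough (wlog : forall x y (n i j : nat) k k', t0 < x < t0 + la -> t0 < y < t0 + la ->
    quiet n y -> (j <= n)%nat -> (i <= j)%nat ->
    fz (Z.of_nat i) x + IZR k = fz (Z.of_nat j) y + IZR k' -> x = y).
  { intros Hx Hy (n & i & k & Q & Hi & E) (n' & j & k' & Q' & Hj & E').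
    destruct (Nat.le_ge_cases i j) as [H | H].
    - apply (wlog x y n' i j k k'); auto. congruence.
    - symmetry. apply (wlog y x n j i k' k); auto. congruence. }
  clear x y. intros x y n i j k k' Hx Hy Q Hj Hij E.
  assert (E' : x = fz (Z.of_nat (j - i)) y + IZR (k' - k)).
  { apply (fz_inj F G F_incr FG (Z.of_nat i)).
    rewrite (fz_add_shift F G F_incr FG F_one), minus_IZR.
    replace (Z.of_nat i + Z.of_nat (j - i))%Z with (Z.of_nat j) by lia. lra. }
  destruct (Nat.eq_dec i j) as [-> | Hne].
  - rewrite Nat.sub_diag in E'. simpl in E'.
    assert (-1 < IZR (k' - k) < 1) as [H1 H2] by lra.
    apply lt_IZR in H1, H2. replace (k' - k)%Z with 0%Z in E' by lia. lra.
  - exfalso. apply (Q (j - i)%nat); [lia|]. exists (k' - k)%Z. lra.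
Qed.

(** * Linearity on an interval without breaks *)

Section Piece.

Variables x1 x2 : R.
Hypothesis Hx : t0 <= x1 /\ x1 < x2 /\ x2 <= t0 + la.
Hypothesis no_break : forall z, x1 < z < x2 -> ~ break z.

Variable k : nat.
Hypothesis Hk : return_time k x1.

(** Strong induction on [j]: a change of membership would come from some [y] past [x1] whose [j]-th
    image is an end of the arc. By induction the earlier images of [y] avoid the arc as those of
    [x1] do, so [y] would be a break. *)
Lemma piece_in_arc j z : x1 <= z < x2 -> (1 <= j <= k)%nat ->
  in_arc (fz (Z.of_nat j) z) <-> in_arc (fz (Z.of_nat j) x1).
Proof.
  revert z. induction j as [j IH] using lt_wf_ind. intros z [[Hz | <-] Hz2] Hj; [|tauto].
  apply NNPP. intros C.
  apply arc_change in C; [|now apply fz_incr].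
  destruct C as (e & He & Hend).
  set (y := fz (- Z.of_nat j) e).
  assert (Ey : fz (Z.of_nat j) y = e) by apply (fzK F G F_incr FG).
  assert (Hy : x1 < y < x2).
  { split; [|apply Rle_lt_trans with (2 := Hz2)].
    - apply (fz_lt_cancel F G F_incr FG (Z.of_nat j)). lra.
    - apply Rnot_lt_le. intros C. apply (fz_incr F G F_incr FG (Z.of_nat j)) in C. lra. }
  apply (no_break y Hy). split; [lra|]. exists j. split.
  - intros i Hi. destruct (Nat.eq_dec i j) as [-> | Hne].
    + rewrite Ey. now apply arc_end_not_open.
    + intros D. apply open_arc_arc in D. apply IH in D; [|lia | lra | lia].
      destruct Hk as (_ & _ & Hmin). apply (Hmin i); [lia | exact D].
  - left. split; [lia|]. now rewrite Ey.
Qed.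

Lemma piece_return_time z : x1 <= z < x2 -> return_time k z.
Proof.
  intros Hz. destruct Hk as (H1 & H2 & H3). split; [exact H1|]. split.
  - apply piece_in_arc; auto.
  - intros j Hj C. apply (H3 j Hj). apply (piece_in_arc j z); auto. lia.
Qed.

Lemma piece_no_zero j t : (j < k)%nat ->
  fz (Z.of_nat j) x1 < t < fz (Z.of_nat j) x2 -> cos (2 * PI * t) <> 0.
Proof.
  intros Hj Ht E. set (y := fz (- Z.of_nat j) t).
  assert (Ey : fz (Z.of_nat j) y = t) by apply (fzK F G F_incr FG).
  assert (Hy : x1 < y < x2).
  { split; apply (fz_lt_cancel F G F_incr FG (Z.of_nat j)); lra. }
  apply (no_break y Hy). split; [lra|]. exists j. split.
  - intros i Hi D. apply open_arc_arc in D.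
    destruct (piece_return_time y) as (_ & _ & H); [lra|]. apply (H i); [lia | exact D].
  - right. now rewrite Ey.
Qed.

Lemma piece_iter_linear j : (j <= k)%nat -> exists M, forall z s, 0 < s -> x1 <= z < x2 ->
  Nat.iter j (Tab a b) (scale s (unit_pt z)) = lin M (scale s (unit_pt z)).
Proof.
  induction j as [|j IH]; intros Hj.
  - exists (1, 0, 0, 1). intros z s _ _. destruct (scale s (unit_pt z)) as [u w].
    unfold lin; simpl. f_equal; ring.
  - destruct IH as [M HM]; [lia|].
    destruct (Tab_linear_between a b (fz (Z.of_nat j) x1) (fz (Z.of_nat j) x2)) as [N HN].
    { intros t. apply piece_no_zero. lia. }
    exists (mat_mul N M). intros z s Hs Hz.
    rewrite lin_mat_mul, <- HM by auto. simpl.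
    destruct (iter_Tab_ray j s z Hs) as (s' & Hs' & ->).
    apply HN; [exact Hs'|]. split.
    + apply fz_le; auto. lra.
    + apply fz_incr; auto. lra.
Qed.

End Piece.

Lemma piece_first_return s0 x1 x2 : 0 < s0 ->
  t0 <= x1 /\ x1 < x2 /\ x2 <= t0 + la -> (forall z, x1 < z < x2 -> ~ break z) ->
  exists M, forall z s, 0 < s -> x1 <= z < x2 ->
    first_return a b (scale s0 (unit_pt t0)) (2 * PI * la)
      (scale s (unit_pt z)) (lin M (scale s (unit_pt z))).
Proof.
  intros Hs0 Hx Hno.
  assert (Hsec : forall (j : nat) s z, 0 < s ->
    in_sector (scale s0 (unit_pt t0)) (2 * PI * la) (Nat.iter j (Tab a b) (scale s (unit_pt z)))
    <-> in_arc (fz (Z.of_nat j) z)).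
  { intros j s z Hs. destruct (iter_Tab_ray j s z Hs) as (s' & Hs' & ->).
    rewrite in_sector_ray by auto. unfold in_arc.
    replace (2 * PI * la / (2 * PI)) with la by (field; apply PI_neq0). tauto. }
  destruct (return_time_exists x1) as [k Hk].
  destruct (piece_iter_linear x1 x2 Hx Hno k Hk k (le_n k)) as [M HM].
  exists M. intros z s Hs Hz.
  destruct (piece_return_time x1 x2 Hx Hno k Hk z Hz) as (H1 & H2 & H3).
  exists k. split; [exact H1|]. split; [now apply Hsec|]. split.
  - intros j Hj1 Hj2 C. apply Hsec in C; [|exact Hs]. apply (H3 j); [lia | exact C].
  - now rewrite HM.
Qed.

(** By [hits_unique] each target in [cs] accounts for at most one cut, and after cutting no piece
    has a break in its interior. *)
Lemma pl_first_return_hits s0 cs : 0 < s0 ->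
  (forall z, break z -> exists c, In c cs /\ hits c z) ->
  pl_first_return a b (scale s0 (unit_pt t0)) (2 * PI * la) (S (length cs)).
Proof.
  intros Hs0 Hcs. assert (HPI := PI_RGT_0).
  destruct (partition_avoiding hits t0 (t0 + la) cs) as (n & th & Hn & H0 & Hend & Hinc & Hav).
  { lra. }
  { intros c x y. apply hits_unique. }
  assert (Hrange : forall i, (i <= n)%nat -> t0 <= th i <= t0 + la).
  { intros i Hi.
    assert (H1 := increasing_le th n Hinc 0 i ltac:(lia) ltac:(lia)).
    assert (H2 := increasing_le th n Hinc i n ltac:(lia) ltac:(lia)). lra. }
  assert (HM : forall i, exists M, (i < n)%nat -> forall z s, 0 < s -> th i <= z < th (S i) ->
    first_return a b (scale s0 (unit_pt t0)) (2 * PI * la)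
      (scale s (unit_pt z)) (lin M (scale s (unit_pt z)))).
  { intros i. destruct (le_lt_dec n i) as [H | H].
    (* Default matrix beyond the last piece, so that one can be chosen for every [i]. *)
    - exists (0, 0, 0, 0). lia.
    - destruct (piece_first_return s0 (th i) (th (S i)) Hs0) as [M HM].
      + split; [apply Hrange; lia|]. split; [now apply Hinc | apply Hrange; lia].
      + intros z Hz C. destruct (Hcs z C) as (c & Hc & Hh). now apply (Hav i z c).
      + now exists M. }
  set (pick := fun i => constructive_indefinite_description _ (HM i)).
  set (M := fun i => proj1_sig (pick i)).
  assert (HM' : forall i, (i < n)%nat -> forall z s, 0 < s -> th i <= z < th (S i) ->
    first_return a b (scale s0 (unit_pt t0)) (2 * PI * la)
      (scale s (unit_pt z)) (lin (M i) (scale s (unit_pt z))))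
    by exact (fun i => proj2_sig (pick i)).
  exists n, (fun i => 2 * PI * (th i - t0)), M.
  split; [exact Hn|]. split; [rewrite H0; ring|]. split; [rewrite Hend; ring|].
  split.
  { intros i Hi. apply Rmult_lt_compat_l; [lra|]. specialize (Hinc i Hi). lra. }
  intros i t phi Hi Ht p. unfold p. rewrite rot_ray, scale_scale.
  assert (Hts : 0 < t * s0) by now apply Rmult_lt_0_compat.
  assert (Hphi : phi = 2 * PI * (phi / (2 * PI))) by (field; lra).
  split.
  - intros [Hl Hr]. apply HM'; auto.
    rewrite Hphi in Hl, Hr. apply Rmult_lt_reg_l in Hl, Hr; lra.
  (* Pieces are closed on the left, so a cutting ray goes with the piece that starts there. *)
  - intros ->. left. apply HM'; auto.
    replace (t0 + 2 * PI * (th i - t0) / (2 * PI)) with (th i) by (field; lra).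
    specialize (Hinc i Hi). lra.
Qed.

Lemma break_hits_four z : break z ->
  exists c, In c (t0 :: t0 + la :: 1 / 4 :: 3 / 4 :: nil) /\ hits c z.
Proof.
  intros (_ & n & Q & [(_ & k & [E | E]) | E]).
  - exists t0. split; [simpl; auto|]. now exists n, n, k.
  - exists (t0 + la). split; [simpl; auto|]. now exists n, n, k.
  - apply cos_turn_zero in E. destruct E as [k [E | E]].
    + exists (1 / 4). split; [simpl; auto|]. exists n, n, (- k)%Z.
      rewrite opp_IZR. repeat split; auto. lra.
    + exists (3 / 4). split; [simpl; auto 6|]. exists n, n, (- k)%Z.
      rewrite opp_IZR. repeat split; auto. lra.
Qed.

Definition in_segment (lo hi j : Z) : Prop := (lo <= j <= hi)%Z \/ j = 0%Z.

(* An orbit segment missing the open arc, prolonged to contain [e] itself, can be entered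
   from the arc only through its first point. *)
Lemma hits_segment_start e lo hi n z j k : (lo <= 1)%Z -> (0 <= hi)%Z ->
  (forall i, (lo <= i <= hi)%Z -> ~ in_open_arc (fz i e)) ->
  t0 < z < t0 + la -> quiet n z -> in_segment lo hi j ->
  fz (Z.of_nat n) z + IZR k = fz j e ->
  hits (fz (Z.min 0 lo) e) z.
Proof.
  intros Hlo Hhi Hout Hz Q Hj E.
  assert (E' : forall d, fz (Z.of_nat n - d) z + IZR k = fz (j - d) e).
  { intros d. replace (Z.of_nat n - d)%Z with (- d + Z.of_nat n)%Z by lia.
    rewrite <- (fz_add_shift F G F_incr FG F_one), E, <- (fz_add F G F_incr FG).
    f_equal. lia. }
  assert (Hjlo : (Z.min 0 lo <= j)%Z) by (destruct Hj; lia).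
  (* With too few steps to come from the first point of the segment, [z] itself would be the point
     of index [j - n]. That index lies in [[lo, hi]] even when [lo = 1], which contradicts
     [Hout]. *)
  destruct (Z_lt_le_dec (Z.of_nat n) (j - Z.min 0 lo)) as [H | H].
  - exfalso. assert (E0 := E' (Z.of_nat n)). rewrite Z.sub_diag in E0. simpl in E0.
    apply (Hout (j - Z.of_nat n)%Z); [destruct Hj; lia|].
    exists (- k)%Z. rewrite opp_IZR, <- E0. lra.
  - exists n, (Z.to_nat (Z.of_nat n - (j - Z.min 0 lo))), k.
    split; [exact Q|]. split; [lia|].
    rewrite Z2Nat.id by lia. rewrite E'. f_equal. lia.
Qed.

(** The ends of the arc lie on the two orbit segments, and the prolonged segments contain [1 / 4]
    and [3 / 4]. Thus every break enters one of them, through its first point. *)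
Lemma break_hits_two lo1 hi1 lo2 hi2 :
  (lo1 <= 1)%Z -> (0 <= hi1)%Z -> (lo2 <= 1)%Z -> (0 <= hi2)%Z ->
  (forall i, (lo1 <= i <= hi1)%Z -> ~ in_open_arc (fz i (1 / 4))) ->
  (forall i, (lo2 <= i <= hi2)%Z -> ~ in_open_arc (fz i (3 / 4))) ->
  (forall z, arc_end z -> exists j k,
     ((lo1 <= j <= hi1)%Z /\ z + IZR k = fz j (1 / 4)) \/
     ((lo2 <= j <= hi2)%Z /\ z + IZR k = fz j (3 / 4))) ->
  forall z, break z ->
  exists c, In c (fz (Z.min 0 lo1) (1 / 4) :: fz (Z.min 0 lo2) (3 / 4) :: nil) /\ hits c z.
Proof.
  intros Hlo1 Hhi1 Hlo2 Hhi2 Hout1 Hout2 Hend z (Hz & n & Q & H).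
  enough (E : exists j k,
    (in_segment lo1 hi1 j /\ fz (Z.of_nat n) z + IZR k = fz j (1 / 4)) \/
    (in_segment lo2 hi2 j /\ fz (Z.of_nat n) z + IZR k = fz j (3 / 4))).
  { destruct E as (j & k & [[Hj E] | [Hj E]]).
    - exists (fz (Z.min 0 lo1) (1 / 4)). split; [simpl; auto|].
      now apply (hits_segment_start _ lo1 hi1 n z j k).
    - exists (fz (Z.min 0 lo2) (3 / 4)). split; [simpl; auto|].
      now apply (hits_segment_start _ lo2 hi2 n z j k). }
  unfold in_segment. destruct H as [[_ H] | H].
  - destruct (Hend _ H) as (j & k & [[Hj E] | [Hj E]]); exists j, k; auto.
  - apply cos_turn_zero in H. destruct H as [k [E | E]]; exists 0%Z, (- k)%Z;
      rewrite opp_IZR, E; simpl; [left | right]; split; auto; ring.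
Qed.

End FirstReturn.

(** * The orbit set and the two bounds *)

Lemma unit_pt_quarter : unit_pt (1 / 4) = (0, 1).
Proof.
  unfold unit_pt. replace (2 * PI * (1 / 4)) with (PI / 2) by field.
  now rewrite cos_PI2, sin_PI2.
Qed.

Lemma unit_pt_three_quarters : unit_pt (3 / 4) = (0, -1).
Proof.
  unfold unit_pt. replace (2 * PI * (3 / 4)) with (3 * (PI / 2)) by field.
  now rewrite cos_3PI2, sin_3PI2.
Qed.

(** Forward and backward parts join into one run of consecutive times for each of the two points;
    the run starts at time 1 when the backward part is empty. *)
Lemma orbit_set_iff a b mp mm np nm p : orbit_set a b mp mm np nm p <->
  exists j,
    ((1 - Z.of_nat mm <= j <= Z.of_nat mp)%Z /\ p = Titer a b j (0, 1)) \/
    ((1 - Z.of_nat nm <= j <= Z.of_nat np)%Z /\ p = Titer a b j (0, -1)).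
Proof.
  split.
  - intros [i [[Hi ->] | [[Hi ->] | [[Hi ->] | [Hi ->]]]]].
    + exists (Z.of_nat (1 + i)). left. split; [lia | reflexivity].
    + exists (- Z.of_nat i)%Z. left. split; [lia | reflexivity].
    + exists (Z.of_nat (1 + i)). right. split; [lia | reflexivity].
    + exists (- Z.of_nat i)%Z. right. split; [lia | reflexivity].
  - intros (j & H). destruct (Z_lt_le_dec 0 j) as [Hj | Hj].
    + exists (Z.to_nat (j - 1)).
      replace (Z.of_nat (1 + Z.to_nat (j - 1))) with j by lia.
      destruct H as [[H E] | [H E]]; [left | right; right; left]; split; auto; lia.
    + exists (Z.to_nat (- j)).
      replace (- Z.of_nat (Z.to_nat (- j)))%Z with j by lia.
      destruct H as [[H E] | [H E]]; [right; left | right; right; right]; split; auto; lia.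
Qed.

Theorem theorem3p1 (a b : R) :
  rotation_number_irrational a b ->
  (forall (v v' : Pt) (al : R),
      v <> (0, 0) -> v' <> (0, 0) -> sector_angle v v' al ->
      pl_first_return a b v al 5) /\
  (forall (mp mm np nm : nat) (v v' : Pt) (al : R),
      v <> (0, 0) -> v' <> (0, 0) -> sector_angle v v' al ->
      orbit_set a b mp mm np nm v -> orbit_set a b mp mm np nm v' ->
      (forall p, orbit_set a b mp mm np nm p -> ~ in_open_sector v al p) ->
      pl_first_return a b v al 3).
Proof.
  intros (F & rho & HF & Hcv & Hirr).
  assert (HPI := PI_RGT_0).
  destruct (HF) as (Hcont & F1 & _).
  assert (Hincr := lift_incr F Hcont F1 (lift_S_inj a b F HF)).
  set (G := fun y => proj1_sig (lift_inverse F Hcont F1 y)).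
  assert (FG : forall y, F (G y) = y) by (intros y; apply (proj2_sig (lift_inverse F Hcont F1 y))).
  assert (aper := irrational_aperiodic F G Hincr FG F1 rho Hcv Hirr).
  assert (Hla : forall al, 0 < al < 2 * PI -> 0 < al / (2 * PI) < 1).
  { intros al Hal. split; [apply Rdiv_lt_0_compat; lra|].
    apply (Rmult_lt_reg_r (2 * PI)); [lra|].
    unfold Rdiv. rewrite Rmult_assoc, Rinv_l; lra. }
  assert (Hal : forall al, al = 2 * PI * (al / (2 * PI))) by (intros; field; lra).
  split.
  - intros v v' al Hv _ [Hsa _].
    destruct (polar v Hv) as (s0 & t0 & Hs0 & ->).
    rewrite (Hal al).
    apply (pl_first_return_hits a b F G HF Hincr FG F1 aper t0 _ (Hla al Hsa) s0
             (t0 :: t0 + al / (2 * PI) :: 1 / 4 :: 3 / 4 :: nil) Hs0).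
    exact (break_hits_four F G t0 _ (Hla al Hsa)).
  - intros mp mm np nm v v' al Hv _ [Hsa (s1 & Hs1 & Ev')] Ov Ov' Hout.
    destruct (polar v Hv) as (s0 & t0 & Hs0 & ->).
    rewrite rot_ray, scale_scale in Ev'.
    assert (Hs10 : 0 < s1 * s0) by now apply Rmult_lt_0_compat.
    set (la := al / (2 * PI)) in *.
    (* The hypothesis that no point of the orbit set is interior to the sector, read on the lift. *)
    assert (Hmiss : forall j s t, 0 < s ->
      orbit_set a b mp mm np nm (Titer a b j (scale s (unit_pt t))) ->
      ~ in_open_arc t0 la (ziter F G j t)).
    { intros j s t Hs O [k Hk]. apply (Hout _ O).
      destruct (Titer_ray a b F G HF FG j s t Hs) as (s' & Hs' & ->).
      now apply (in_open_sector_ray s0 t0 al s' _ k). }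
    assert (Hpos : forall s z, 0 < s -> orbit_set a b mp mm np nm (scale s (unit_pt z)) ->
      exists j k,
        ((1 - Z.of_nat mm <= j <= Z.of_nat mp)%Z /\ z + IZR k = ziter F G j (1 / 4)) \/
        ((1 - Z.of_nat nm <= j <= Z.of_nat np)%Z /\ z + IZR k = ziter F G j (3 / 4))).
    { intros s z Hs O. apply orbit_set_iff in O.
      destruct O as [j [[Hj E] | [Hj E]]]; exists j.
      - rewrite <- unit_pt_quarter, <- (scale_1 (unit_pt (1 / 4))) in E.
        destruct (Titer_ray a b F G HF FG j 1 (1 / 4) Rlt_0_1) as (s' & Hs' & E').
        rewrite E' in E. apply ray_inj in E; auto. destruct E as [k E]. exists k. auto.
      - rewrite <- unit_pt_three_quarters, <- (scale_1 (unit_pt (3 / 4))) in E.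
        destruct (Titer_ray a b F G HF FG j 1 (3 / 4) Rlt_0_1) as (s' & Hs' & E').
        rewrite E' in E. apply ray_inj in E; auto. destruct E as [k E]. exists k. auto. }
    assert (Hend : forall z, arc_end t0 la z -> exists j k,
        ((1 - Z.of_nat mm <= j <= Z.of_nat mp)%Z /\ z + IZR k = ziter F G j (1 / 4)) \/
        ((1 - Z.of_nat nm <= j <= Z.of_nat np)%Z /\ z + IZR k = ziter F G j (3 / 4))).
    { intros z (k & [E | E]).
      - apply (Hpos s0 z Hs0). now rewrite <- (unit_pt_shift z k), E.
      - apply (Hpos (s1 * s0) z Hs10). now rewrite <- (unit_pt_shift z k), E, <- Ev'. }
    rewrite (Hal al). fold la.
    (* The two targets are the first points of the segments prolonged to time 0; two targets give
       three pieces. *)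
    apply (pl_first_return_hits a b F G HF Hincr FG F1 aper t0 la (Hla al Hsa) s0
             (ziter F G (Z.min 0 (1 - Z.of_nat mm)) (1 / 4) ::
              ziter F G (Z.min 0 (1 - Z.of_nat nm)) (3 / 4) :: nil) Hs0).
    apply (break_hits_two F G Hincr FG F1 t0 la _ (Z.of_nat mp) _ (Z.of_nat np));
      try lia; try exact Hend; intros i Hi; apply (Hmiss i 1); try lra; rewrite scale_1.
    + rewrite unit_pt_quarter. apply orbit_set_iff. exists i. auto.
    + rewrite unit_pt_three_quarters. apply orbit_set_iff. exists i. auto.
Qed.
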